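(* Let $F$ be an algebraically closed field. (i) Let $A$ be a prolongable monomial $F$-algebra for which $\mathcal P(A)$ is irreducible. Then there is a surjective homomorphism from $A$ onto a free algebra whose kernel is nilpotent. (ii) If $A$ is a prolongable monomial $F$-algebra for which $\mathcal P(A)$ is isomorphic to the proalgebraic variety of point modules of a free algebra $F\langle x_1,\dots,x_d\rangle$, then $A$ is free.
   Context: A monomial algebra is a quotient $A=F\langle x_1,\dots,x_m\rangle/I$ of a finitely generated free associative algebra by a proper ideal generated by monomials, graded by $\deg x_i=1$. It is (right) prolongable if for every non-zero monomial $u\in A$ there is a non-empty monomial $v$ with $uv\neq0$. A point module is a graded cyclic right $A$-module $P=\bigoplus_{n\ge0}P_n$ generated in degree $0$ with all $\dim_F P_n=1$. Writing $P_i=Fe_i$ and $e_i\cdot x_j=\lambda_{i,j}e_{i+1}$, the isomorphism class of $P$ is recorded by the point $(\underline\lambda_0,\underline\lambda_1,\dots)\in\mathbb P^{m-1}\times\mathbb P^{m-1}\times\cdots$, $\underline\lambda_i=[\lambda_{i,1}:\cdots:\lambda_{i,m}]$. The set of all such points is $\varprojlim\mathcal P(A)$; $\mathcal P_n(A)\subseteq(\mathbb P^{m-1})^{\times(n+1)}$ is its image under projection to the first $n+1$ factors (a projective variety), $\pi_n\colon\mathcal P_{n+1}(A)\to\mathcal P_n(A)$ is the natural projection, and $\mathcal P(A)=\{(\mathcal P_n(A),\pi_n)\}_{n\ge0}$. A proalgebraic variety is a sequence $\{(V_n,\varphi_n)\}_{n\ge0}$ of algebraic varieties and surjective morphisms $\varphi_n\colon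 V_{n+1}\to V_n$; $\varphi^{i'}_i\colon V_{i'}\to V_i$ denotes the composite. It is irreducible if each $V_n$ is irreducible. Its points are compatible sequences $(a_n)_n$ with $a_n\in V_n$. A morphism $\{(V_n,\varphi_n)\}\to\{(W_n,\psi_n)\}$ consists of an order-preserving $g\colon\mathbb N\to\mathbb N$ (possibly defined only for large arguments) and morphisms of varieties $f_j\colon V_{g(j)}\to W_j$ with $f_j\circ\varphi^{g(j')}_{g(j)}=\psi^{j'}_j\circ f_{j'}$ for $j\le j'$; it induces a map on points. An isomorphism is a morphism with an inverse morphism, i.e. the induced maps on points are mutually inverse. *)

(* Defs.v *)
From HB Require Import structures.
From mathcomp Require Import all_boot all_order all_algebra.
From mathcomp Require Import finmap monalg mpoly.
From mathcomp Require Import boolp classical_sets functions.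

Set Implicit Arguments.
Unset Strict Implicit.
Unset Printing Implicit Defensive.

Import GRing.Theory.
Local Open Scope classical_set_scope.
Local Open Scope ring_scope.

Section GeneratedIdeals.
Variable R : nzRingType.

Definition gen_ideal (S : set R) : set R :=
  [set f | exists2 s : seq (R * R * R), (forall t, t \in s -> S t.1.2)
     & f = \sum_(t <- s) t.1.1 * t.1.2 * t.2].

Definition nilpotent_ideal (K : set R) : Prop :=
  exists N : nat, forall s : seq R,
    size s = N -> (forall a, a \in s -> K a) -> \prod_(a <- s) a = 0.

End GeneratedIdeals.

(* The library only makes [{malg F[K]}] an [algType] for commutative monoids
   [K], hence the new name and the instance below. *)
Definition free_alg (F : fieldType) (m : nat) := {malg F[{fmonom 'I_m}]}.

HB.instance Definition _ (F : fieldType) (m : nat) :=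
  GRing.Lalgebra.on (free_alg F m).

Fact free_alg_scalerAr (F : fieldType) (m : nat) (c : F) (f g : free_alg F m) :
  c *: (f * g) = f * (c *: g).
Proof.
apply/malgP => k; rewrite monalg.mcoeffZ.
rewrite (mcoeffMlw k (fsubset_refl _) (fsubset_refl _)).
rewrite (mcoeffMlw k (fsubset_refl _) (monalg.msuppZ_le c g)) big_distrr.
apply: eq_bigr => k1 _; rewrite big_distrr; apply: eq_bigr => k2 _ /=.
by rewrite monalg.mcoeffZ mulrnAr mulrCA.
Qed.

HB.instance Definition _ (F : fieldType) (m : nat) :=
  GRing.Lalgebra_isAlgebra.Build F (free_alg F m) (@free_alg_scalerAr F m).

Definition word (F : fieldType) (m : nat) (w : seq 'I_m) : free_alg F m :=
  << FMonom w >>.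

Arguments word F {m} w.

Definition homogeneous (F : fieldType) (m k : nat) : set (free_alg F m) :=
  [set f | forall w : {fmonom 'I_m}, w \in monalg.msupp f -> size w = k].

(* The quotient of [free_alg F (ngens A)] by an ideal generated by words is
   given, up to isomorphism, by a surjection whose kernel is such an ideal; the
   ideal is proper because an [algType] is nontrivial. *)
Record monomial_algebra (F : fieldType) := MonomialAlgebra {
  ngens : nat;
  mon_alg :> algType F;
  mon_proj : {lrmorphism free_alg F ngens -> mon_alg};
  mon_proj_surj : forall a : mon_alg, exists f, mon_proj f = a;
  mon_proj_ker : exists S : set (seq 'I_ngens),
    [set f | mon_proj f = 0] = gen_ideal [set word F w | w in S]
}.

Definition monomial (F : fieldType) (A : monomial_algebra F)
    (w : seq 'I_(ngens A)) : A :=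
  mon_proj A (word F w).

Definition prolongable (F : fieldType) (A : monomial_algebra F) : Prop :=
  forall u : seq 'I_(ngens A), monomial u != 0 ->
  exists2 v : seq 'I_(ngens A), v <> [::] & monomial u * monomial v != 0.

Definition is_free_algebra (F : fieldType) (A : algType F) : Prop :=
  exists (d : nat) (phi : {lrmorphism A -> free_alg F d}), bijective phi.

Section FreeMonomialAlgebra.
Variables (F : fieldType) (m : nat).

Fact idfun_surj (a : free_alg F m) : exists f : free_alg F m, idfun f = a.
Proof. by exists a. Qed.

Fact idfun_ker : exists S : set (seq 'I_m),
  [set f : free_alg F m | idfun f = 0] = gen_ideal [set word F w | w in S].
Proof.
exists set0; apply/seteqP; split=> f /=.
  by move=> ->; exists [::] => //; rewrite big_nil.
case=> s sS ->; rewrite big_seq big1 // => t ts.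
by have [w []] := sS t ts.
Qed.

Definition free_monomial_algebra : monomial_algebra F :=
  @MonomialAlgebra F m (free_alg F m) idfun idfun_surj idfun_ker.

End FreeMonomialAlgebra.

Definition proj_space (F : fieldType) (m : nat) :=
  {L : {vspace 'rV[F]_m} | \dim L == 1%N}.

Definition hcoord (F : fieldType) (m : nat) (p : proj_space F m)
    (v : 'rV[F]_m) : Prop :=
  val p = <[v]>%VS.

(* A right [A]-module is a left module over the converse ring [A^c]. *)
Definition ract (F : fieldType) (A : algType F) (P : lmodType A^c)
    (v : P) (a : A) : P :=
  (a : A^c) *: v.

Definition Fline (F : fieldType) (A : algType F) (P : lmodType A^c) (v : P) :
    set P :=
  [set ract v c%:A | c in [set: F]].

(* [E n] is the component [P_n]; [pm_span] and [pm_direct] say that [P] is the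
   direct sum of the [P_n], and [pm_cyclic] that [P = P_0 A]. *)
Record point_module (F : fieldType) (A : monomial_algebra F)
    (P : lmodType A^c) (E : nat -> set P) : Prop := PointModule {
  pm_dim1 : forall n, exists2 e, e != 0 & E n = Fline e;
  pm_span : forall v, exists N (x : nat -> P),
    (forall n, E n (x n)) /\ v = \sum_(n < N) x n;
  pm_direct : forall N (x : nat -> P), (forall n, E n (x n)) ->
    \sum_(n < N) x n = 0 -> forall n, (n < N)%N -> x n = 0;
  pm_graded : forall n k v f, E n v -> homogeneous k f ->
    E (n + k)%N (ract v (mon_proj A f));
  pm_cyclic : exists2 v, E 0%N v & forall w, exists a, w = ract v a
}.

(* [p] is the point recorded by the module: [P_i = F e_i] and
   [e_i x_j = e_(i+1) lam_(i,j)]. *)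
Definition point_of_module (F : fieldType) (A : monomial_algebra F)
    (P : lmodType A^c) (E : nat -> set P)
    (p : nat -> proj_space F (ngens A)) : Prop :=
  exists (e : nat -> P) (lam : nat -> 'rV[F]_(ngens A)),
  [/\ forall i, e i != 0 /\ E i = Fline (e i),
      forall i j, ract (e i) (monomial [:: j]) = ract (e i.+1) (lam i 0 j)%:A
    & forall i, hcoord (p i) (lam i)].

Definition point_seqs (F : fieldType) (A : monomial_algebra F) :
    set (nat -> proj_space F (ngens A)) :=
  [set p | exists (P : lmodType A^c) (E : nat -> set P),
     point_module E /\ point_of_module E p].
Arguments point_seqs {F} A.

Section Varieties.
Variable F : closedFieldType.

(* [mproj k m] is the [k]-fold power of the projective space of lines in
   [F^m]. *)
Definition mproj (k m : nat) := {ffun 'I_k -> proj_space F m}.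

(* Row [i] of [M] is a vector of homogeneous coordinates of the [i]-th factor;
   the variable of index [mxvec_index i j] stands for the entry [M i j]. *)
Definition mcoord k m (x : mproj k m) (M : 'M[F]_(k, m)) : Prop :=
  forall i, hcoord (x i) (row i M).

(* [mpoly n F] is the ring written [{mpoly F[n]}] in [mpoly]; that notation is
   shadowed by the one of [monalg]. *)
Definition mxeval k m (M : 'M[F]_(k, m)) (q : mpoly (k * m) F) : F :=
  q.@[mxvec M 0].

Definition multihomog k m (d : 'I_k -> nat) (q : mpoly (k * m) F) : Prop :=
  forall mm : multinom (k * m), mm \in msupp q ->
  forall i, (\sum_(j < m) mm (mxvec_index i j) = d i)%N.

(* Whether a multihomogeneous polynomial vanishes at a point does not depend on
   the homogeneous coordinates chosen. *)
Definition zero_locus k m (S : set (mpoly (k * m) F)) : set (mproj k m) :=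
  [set x | forall q, S q -> forall M, mcoord x M -> mxeval M q = 0].

Definition zariski_closed k m (Z : set (mproj k m)) : Prop :=
  exists2 S : set (mpoly (k * m) F),
    (forall q, S q -> exists d, multihomog d q) & Z = zero_locus S.

(* A multiprojective variety; it need not be irreducible. Powers of a single
   projective space suffice, as all factors of a product of projective spaces
   embed linearly in the largest one. *)
Record variety := Variety {
  nfactors : nat;
  ncoords : nat;
  vset :> set (mproj nfactors ncoords);
  vset_closed : zariski_closed vset
}.

Definition vclosed (X : variety) (Z : set X) : Prop :=
  exists2 C, zariski_closed C & Z = [set x | C (val x)].

Definition vopen (X : variety) (U : set X) : Prop := vclosed (~` U).

Definition virreducible (X : variety) : Prop :=
  [set: X] !=set0 /\
  forall Z1 Z2 : set X, vclosed Z1 -> vclosed Z2 ->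
    Z1 `|` Z2 = setT -> Z1 = setT \/ Z2 = setT.

(* Locally a quotient of multihomogeneous polynomials of equal multidegree. *)
Definition regular_on (X : variety) (U : set X) (h : X -> F) : Prop :=
  forall x, U x -> exists O : set X, [/\ vopen O, O x &
    exists d q r, [/\ multihomog d q, multihomog d r &
      forall y, O y -> U y -> forall M, mcoord (val y) M ->
        mxeval M r != 0 /\ h y = mxeval M q / mxeval M r]].

Definition vmorphism (X Y : variety) (f : X -> Y) : Prop :=
  (forall Z : set Y, vclosed Z -> vclosed (f @^-1` Z)) /\
  (forall (U : set Y) (h : Y -> F), vopen U -> regular_on U h ->
     regular_on (f @^-1` U) (h \o f)).

Record proalgebraic := Proalgebraic {
  pa_var : nat -> variety;
  pa_map : forall n, pa_var n.+1 -> pa_var n;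
  pa_map_morphism : forall n, vmorphism (@pa_map n);
  pa_map_surj : forall n y, exists x, @pa_map n x = y
}.

Definition pa_irreducible (X : proalgebraic) : Prop :=
  forall n, virreducible (pa_var X n).

Fixpoint pa_comp (X : proalgebraic) (k n : nat) :
    pa_var X (k + n) -> pa_var X n :=
  match k with
  | 0 => id
  | k'.+1 => fun x => pa_comp (pa_map x)
  end.

Definition pa_trans (X : proalgebraic) (i i' : nat) (le_ii' : (i <= i')%N)
    (x : pa_var X i') : pa_var X i :=
  pa_comp (ecast n (pa_var X n) (esym (subnK le_ii')) x).

Definition pa_point (X : proalgebraic) :=
  {a : forall n, pa_var X n | forall n, pa_map (a n.+1) = a n}.

(* The order-preserving map [mor_index] is only relevant, and the morphisms
   [mor_fun] only given, from [mor_start] on. *)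
Record pa_morphism (X Y : proalgebraic) := PaMorphism {
  mor_start : nat;
  mor_index : nat -> nat;
  mor_index_mono : forall j j', (mor_start <= j)%N -> (j <= j')%N ->
    (mor_index j <= mor_index j')%N;
  mor_fun : forall j, (mor_start <= j)%N -> pa_var X (mor_index j) -> pa_var Y j;
  mor_fun_morphism : forall j (sj : (mor_start <= j)%N), vmorphism (mor_fun sj);
  mor_fun_comm : forall j j' (sj : (mor_start <= j)%N) (sj' : (mor_start <= j')%N)
    (jj' : (j <= j')%N) (x : pa_var X (mor_index j')),
    mor_fun sj (pa_trans (mor_index_mono sj jj') x) =
    pa_trans jj' (mor_fun sj' x)
}.

Section PaTrans.
Variable X : proalgebraic.

Fact pa_trans_refl n (le_nn : (n <= n)%N) (x : pa_var X n) :
  pa_trans le_nn x = x.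
Proof.
rewrite /pa_trans; move: (esym (subnK le_nn)).
by rewrite subnn => e; rewrite eq_axiomK.
Qed.

Fact pa_transS i n (le_in : (i <= n)%N) (le_in1 : (i <= n.+1)%N)
    (x : pa_var X n.+1) :
  pa_trans le_in1 x = pa_trans le_in (pa_map x).
Proof.
rewrite /pa_trans; move: (esym (subnK le_in1)) (esym (subnK le_in)).
rewrite subSn //; move: (n - i)%N => k e1 e2.
move: x e1 {le_in le_in1}; subst n => x e1.
by rewrite (eq_irrelevance e1 (erefl _ : (k + i).+1 = (k.+1 + i)%N)).
Qed.

Fact pa_trans_comp i j n (le_ij : (i <= j)%N) (le_jn : (j <= n)%N)
    (le_in : (i <= n)%N) (x : pa_var X n) :
  pa_trans le_ij (pa_trans le_jn x) = pa_trans le_in x.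
Proof.
elim: n le_jn le_in x => [|n IHn] le_jn le_in x.
  have e : j = 0%N by apply/eqP; rewrite -leqn0.
  subst j; rewrite pa_trans_refl.
  by congr (pa_trans _ x); exact: bool_irrelevance.
have [lt_jn|ge_jn] := leqP j n.
  have le_in' : (i <= n)%N := leq_trans le_ij lt_jn.
  by rewrite (pa_transS lt_jn) IHn -pa_transS.
have e : j = n.+1 by apply/eqP; rewrite eqn_leq le_jn.
subst j; rewrite pa_trans_refl.
by congr (pa_trans _ x); exact: bool_irrelevance.
Qed.

Fact pa_trans_point (a : pa_point X) i n (le_in : (i <= n)%N) :
  pa_trans le_in (sval a n) = sval a i.
Proof.
elim: n le_in => [|n IHn] le_in.
  have e : i = 0%N by apply/eqP; rewrite -leqn0.
  by subst i; rewrite pa_trans_refl.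
have [lt_in|ge_in] := leqP i n.
  by rewrite (pa_transS lt_in) (proj2_sig a) IHn.
have e : i = n.+1 by apply/eqP; rewrite eqn_leq le_in.
by subst i; rewrite pa_trans_refl.
Qed.

End PaTrans.

Section PaMorphismPoints.
Variables (X Y : proalgebraic) (f : pa_morphism X Y) (a : pa_point X).

Definition pa_image_coord (j : nat) : pa_var Y j :=
  pa_trans (leq_maxl j (mor_start f))
    (mor_fun (leq_maxr j (mor_start f)) (sval a (mor_index f _))).

Fact pa_image_coordE j n (le_jn : (j <= n)%N) (sn : (mor_start f <= n)%N) :
  pa_image_coord j = pa_trans le_jn (mor_fun sn (sval a (mor_index f n))).
Proof.
rewrite /pa_image_coord; set n0 := maxn _ _.
have le_n0n : (n0 <= n)%N by rewrite geq_max le_jn.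
rewrite -(pa_trans_comp (leq_maxl j (mor_start f)) le_n0n).
rewrite -(mor_fun_comm (leq_maxr j (mor_start f))).
by rewrite pa_trans_point.
Qed.

Fact pa_image_compat n : pa_map (pa_image_coord n.+1) = pa_image_coord n.
Proof.
set N := maxn n.+1 (mor_start f).
have le_n1N : (n.+1 <= N)%N := leq_maxl _ _.
rewrite (pa_image_coordE le_n1N (leq_maxr _ _)).
rewrite (pa_image_coordE (ltnW le_n1N) (leq_maxr _ _)).
rewrite -(pa_trans_comp (leqnSn n) le_n1N).
by rewrite (pa_transS (leqnn n)) pa_trans_refl.
Qed.

Definition pa_image : pa_point Y :=
  exist (fun b : forall n, pa_var Y n => forall n, pa_map (b n.+1) = b n)
    pa_image_coord pa_image_compat.

End PaMorphismPoints.

Definition pa_isomorphic (X Y : proalgebraic) : Prop :=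
  exists (f : pa_morphism X Y) (g : pa_morphism Y X),
    cancel (pa_image f) (pa_image g) /\ cancel (pa_image g) (pa_image f).

End Varieties.

Section HomogeneousCoordinates.
Variables (F : fieldType) (m : nat).
Implicit Types (p : proj_space F m) (v : 'rV[F]_m).

Fact hcoord_neq0 p v : hcoord p v -> v != 0.
Proof.
by rewrite /hcoord; case: p => L /= /eqP dL eL; move: dL; rewrite eL dim_vline;
  case: (v != 0).
Qed.

Fact hcoord_exists p : exists v, hcoord p v.
Proof.
exists (vpick (val p)); apply/esym/eqP; rewrite eqEdim -memvE memv_pick.
rewrite (eqP (valP p)) dim_vline vpick0 -dimv_eq0.
by rewrite (eqP (valP p)).
Qed.

Fact hcoord_scale p v v' : hcoord p v -> hcoord p v' ->
  exists2 c, c != 0 & v' = c *: v.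
Proof.
move=> pv pv'; have /vlineP[c v'E] : (v' \in <[v]>)%VS.
  by rewrite -pv pv' memv_line.
exists c => //; apply: contraNneq (hcoord_neq0 pv') => c0.
by rewrite v'E c0 scale0r.
Qed.

End HomogeneousCoordinates.

Fixpoint path_coef (F : fieldType) (m : nat) (lam : nat -> 'rV[F]_m) (i : nat)
    (w : seq 'I_m) : F :=
  if w is j :: w' then lam i 0 j * path_coef lam i.+1 w' else 1.

Section PathCoef.
Variables (F : fieldType) (m : nat).
Implicit Types (lam : nat -> 'rV[F]_m).

Fact path_coef_cat lam i w1 w2 :
  path_coef lam i (w1 ++ w2) =
  path_coef lam i w1 * path_coef lam (i + size w1) w2.
Proof.
elim: w1 i => [|j w1 IHw] i /=; first by rewrite mul1r addn0.
by rewrite IHw mulrA addSnnS.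
Qed.

Fact path_coef_supp lam lam' i w :
  (forall i j, lam' i 0 j != 0 -> lam i 0 j != 0) ->
  path_coef lam' i w != 0 -> path_coef lam i w != 0.
Proof.
move=> ll'; elim: w i => //= j w IHw i.
by rewrite !mulf_eq0 !negb_or => /andP[/ll' -> /IHw ->].
Qed.

End PathCoef.

Section PointModules.
Variables (F : fieldType) (A : monomial_algebra F).
Let m := ngens A.

Fact monomial_cat (w1 w2 : seq 'I_m) :
  @monomial F A (w1 ++ w2) = monomial w1 * monomial w2.
Proof.
rewrite /monomial -rmorphM; congr (mon_proj A _).
apply/esym; apply: (etrans (fgmulUU _ _ _ _)).
by rewrite /word mulr1; congr << _ >>; exact: fmmulE.
Qed.

Fact monomial_nil : @monomial F A [::] = 1.
Proof.
rewrite /monomial -[RHS](rmorph1 (mon_proj A)); congr (mon_proj A _).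
by apply: (congr1 (fun u : {fmonom 'I_m} => << u >>)); rewrite -fmoneE.
Qed.

Section Necessary.
Variables (P : lmodType A^c) (E : nat -> set P).

Fact ractM (v : P) (a b : A) : ract v (a * b) = ract (ract v a) b.
Proof. by rewrite /ract scalerA. Qed.

Fact ractC (v : P) (a : A) (c : F) :
  ract (ract v c%:A) a = ract (ract v a) c%:A.
Proof. by rewrite -!ractM mulr_algl mulr_algr. Qed.

Fact ract_alg_eq0 (v : P) (c : F) : v != 0 -> ract v c%:A = 0 -> c = 0.
Proof.
move=> v0 vc0; apply: contraNeq v0 => c0; apply/eqP.
have : ract (ract v c%:A) c^-1%:A = 0 by rewrite vc0 /ract scaler0.
by rewrite -ractM -scalerAl mul1r scalerA divff // scale1r /ract scale1r.
Qed.

Variables (e : nat -> P) (lam : nat -> 'rV[F]_m).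
Hypothesis e_act : forall i j,
  ract (e i) (@monomial F A [:: j]) = ract (e i.+1) (lam i 0 j)%:A.

Fact ract_word i (w : seq 'I_m) :
  ract (e i) (@monomial F A w) = ract (e (i + size w)) (path_coef lam i w)%:A.
Proof.
elim: w i => [|j w IHw] i.
  by rewrite monomial_nil addn0 /= scale1r.
rewrite -cat1s monomial_cat ractM e_act ractC IHw -ractM /= addSnnS.
by rewrite -scalerAl mul1r scalerA mulrC.
Qed.

End Necessary.

Fact point_seqs_path_coef (p : nat -> proj_space F m) (lam : nat -> 'rV[F]_m) :
  point_seqs A p -> (forall i, hcoord (p i) (lam i)) ->
  forall w, @monomial F A w = 0 -> forall i, path_coef lam i w = 0.
Proof.
case=> P [E [pmE [e [lam' [eE e_act plam']]]]] plam w w0 i.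
have : path_coef lam' i w = 0.
  apply: (@ract_alg_eq0 P (e (i + size w))); first by case: (eE (i + size w)%N).
  by rewrite -(ract_word e_act) w0 /ract scale0r.
apply: contra_eq; apply: path_coef_supp => {}i j.
have [c c0 ->] := hcoord_scale (plam' i) (plam i).
by rewrite mxE mulf_eq0 negb_or => /andP[].
Qed.

Section Sufficient.
Variable lam : nat -> 'rV[F]_m.
Hypothesis lam_neq0 : forall i, lam i != 0.
Hypothesis lam_rel :
  forall w, @monomial F A w = 0 -> forall i, path_coef lam i w = 0.

Definition word_act (w : seq 'I_m) (v : {poly F}) : {poly F} :=
  \poly_(n < size v + size w)
    if (size w <= n)%N then v`_(n - size w) * path_coef lam (n - size w) w
    else 0.

Fact coef_word_act w v n : (word_act w v)`_n =
  if (size w <= n)%N then v`_(n - size w) * path_coef lam (n - size w) w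
  else 0.
Proof.
rewrite coef_poly; case: ltnP => // le_n; case: leqP => // le_w.
by rewrite nth_default ?mul0r // leq_subRL // addnC.
Qed.

Fact word_act_sum w I (r : seq I) (c : I -> F) (v : I -> {poly F}) :
  word_act w (\sum_(i <- r) c i *: v i) = \sum_(i <- r) c i *: word_act w (v i).
Proof.
apply/polyP => n; rewrite coef_word_act !coef_sum; case: leqP => le_w.
  rewrite mulr_suml; apply: eq_bigr => i _.
  by rewrite !coefZ coef_word_act le_w mulrA.
by rewrite big1 // => i _; rewrite coefZ coef_word_act leqNgt le_w mulr0.
Qed.

Fact word_actD w : {morph word_act w : u v / u + v}.
Proof.
move=> u v; apply/polyP => n; rewrite !(coefD, coef_word_act).
by case: leqP => _; rewrite ?addr0 // mulrDl.
Qed.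

Fact word_act_cat w1 w2 v :
  word_act (w1 ++ w2) v = word_act w2 (word_act w1 v).
Proof.
apply/polyP => n; rewrite !coef_word_act size_cat.
case: (leqP (size w2) n) => [le2|lt2]; last first.
  by rewrite leqNgt (leq_trans lt2) ?leq_addl.
rewrite addnC -leq_subRL //.
case: (leqP (size w1) (n - size w2)) => [le1|lt1]; last by rewrite mul0r.
have -> : (n - (size w2 + size w1) = n - size w2 - size w1)%N by rewrite subnDA.
by rewrite path_coef_cat subnK // mulrA.
Qed.

Fact word_act_nil v : word_act [::] v = v.
Proof. by apply/polyP => n; rewrite coef_word_act /= subn0 mulr1. Qed.

Fact word_act_killed w v : @monomial F A w = 0 -> word_act w v = 0.
Proof.
move=> w0; apply/polyP => n; rewrite coef_word_act coef0.
by rewrite (lam_rel w0) mulr0 if_same.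
Qed.

Fact word_actXn w n :
  word_act w 'X^n = path_coef lam n w *: 'X^(n + size w).
Proof.
apply/polyP => k; rewrite coef_word_act coefZ !coefXn.
case: leqP => [le|lt].
  rewrite -(eqn_add2r (size w)) subnK //; case: eqP => [->|]; last first.
    by rewrite mul0r mulr0.
  by rewrite addnK mul1r mulr1.
by case: eqP lt => [->|_ _]; rewrite ?mulr0 // ltnNge leq_addl.
Qed.

Definition free_act (v : {poly F}) (f : {malg F[{fmonom 'I_m}]}) : {poly F} :=
  monalg.mmap (@polyC F) (fun w : {fmonom 'I_m} => word_act w v) f.

Fact free_actE v f :
  free_act v f = \sum_(w <- monalg.msupp f) monalg.mcoeff w f *: word_act w v.
Proof. by rewrite /free_act monalg.mmapE; apply: eq_bigr => w _; rewrite mul_polyC. Qed.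

Fact free_actU v c w : free_act v << c *g w >> = c *: word_act w v.
Proof. by rewrite /free_act monalg.mmapU mul_polyC. Qed.

Fact free_actDl f : {morph free_act^~ f : u v / u + v}.
Proof.
move=> u v; rewrite !free_actE -big_split; apply: eq_bigr => w _ /=.
by rewrite word_actD scalerDr.
Qed.

Fact free_act0 f : free_act 0 f = 0.
Proof. by apply: (@addrI _ (free_act 0 f)); rewrite -free_actDl !addr0. Qed.

Fact free_act_sum v I (r : seq I) (f : I -> {malg F[{fmonom 'I_m}]}) :
  free_act v (\sum_(i <- r) f i) = \sum_(i <- r) free_act v (f i).
Proof. exact: raddf_sum. Qed.

Fact free_actM v (f g : {malg F[{fmonom 'I_m}]}) :
  free_act v (f * g) = free_act (free_act v f) g.
Proof.
rewrite malgME free_act_sum.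
under eq_bigr => w1 _.
  rewrite free_act_sum.
  under eq_bigr => w2 _ do rewrite free_actU fmM word_act_cat mulrC -scalerA.
  over.
rewrite exchange_big [RHS]free_actE; apply: eq_bigr => w2 _ /=.
by rewrite -scaler_sumr [in RHS]free_actE word_act_sum.
Qed.

Fact free_act_ker v (f : free_alg F m) : mon_proj A f = 0 -> free_act v f = 0.
Proof.
have [S kerS] := mon_proj_ker A; move=> f0.
have [s sS ->] : gen_ideal [set word F w | w in S] f by rewrite -kerS.
rewrite free_act_sum big_seq big1 // => t /sS[w Sw <-].
rewrite !free_actM /word free_actU scale1r word_act_killed.
  exact: free_act0.
rewrite /monomial; change ([set f | mon_proj A f = 0] (word F w)).
rewrite kerS; exists [:: (1, word F w, 1)]; last first.
  by rewrite big_seq1 mul1r mulr1.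
by move=> _ /[!inE] /eqP -> /=; exists w.
Qed.

Definition mon_lift (a : A) : free_alg F m := sval (cid (mon_proj_surj a)).

Fact mon_liftK a : mon_proj A (mon_lift a) = a.
Proof. exact: (svalP (cid (mon_proj_surj a))). Qed.

Definition mod_act (a : A) (v : {poly F}) : {poly F} := free_act v (mon_lift a).

Fact mon_projD f g : mon_proj A (f + g) = mon_proj A f + mon_proj A g.
Proof. exact: rmorphD. Qed.

Fact mon_projM f g : mon_proj A (f * g) = mon_proj A f * mon_proj A g.
Proof. exact: rmorphM. Qed.

Fact mod_actE f v : mod_act (mon_proj A f) v = free_act v f.
Proof.
apply/eqP; rewrite -subr_eq0 /mod_act /free_act -raddfB; apply/eqP.
by apply: free_act_ker; rewrite rmorphB /= mon_liftK subrr.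
Qed.

Fact mod_actA (a b : A) v : mod_act a (mod_act b v) = mod_act (b * a) v.
Proof.
by rewrite -[in RHS](mon_liftK a) -[in RHS](mon_liftK b) -mon_projM mod_actE free_actM.
Qed.

Fact mod_act1 v : mod_act 1 v = v.
Proof.
rewrite -monomial_nil /monomial mod_actE /word free_actU scale1r.
exact: word_act_nil.
Qed.

Fact mod_actDr a : {morph mod_act a : u v / u + v}.
Proof. exact: free_actDl. Qed.

Fact mod_actDl v : {morph mod_act^~ v : a b / a + b}.
Proof.
move=> a b; rewrite -[in LHS](mon_liftK a) -[in LHS](mon_liftK b) -mon_projD mod_actE.
exact: raddfD.
Qed.

Definition pm_carrier : Type := {poly F}.
HB.instance Definition _ := GRing.Zmodule.on pm_carrier.

Definition pm_scale (a : A^c) (v : pm_carrier) : pm_carrier := mod_act a v.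

Fact pm_scaleA (a b : A^c) v : pm_scale a (pm_scale b v) = pm_scale (a * b) v.
Proof. exact: mod_actA. Qed.

Fact pm_scale1 : left_id 1 pm_scale.
Proof. exact: mod_act1. Qed.

Fact pm_scaleDr : right_distributive pm_scale +%R.
Proof. by move=> a u v; exact: mod_actDr. Qed.

Fact pm_scaleDl v : {morph pm_scale^~ v : a b / a + b}.
Proof. exact: mod_actDl. Qed.

Definition pm_lmod_mixin := GRing.Zmodule_isLmodule.Build A^c pm_carrier
  pm_scaleA pm_scale1 pm_scaleDr pm_scaleDl.

Definition pm_lmod : lmodType A^c := HB.pack pm_carrier pm_lmod_mixin.

Fact pm_ractE (v : pm_lmod) f : ract v (mon_proj A f) = free_act v f.
Proof. exact: mod_actE. Qed.

Fact pm_ract_alg (v : pm_lmod) (c : F) :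
  ract v (c%:A : A) = c *: (v : {poly F}) :> {poly F}.
Proof.
rewrite -(rmorph1 (mon_proj A)) -linearZ pm_ractE.
have -> : c *: 1 = << c *g (mone : {fmonom 'I_m}) >> :> {malg F[{fmonom 'I_m}]}.
  by rewrite -mul_malgC; exact: mulr1.
by rewrite free_actU fm1 word_act_nil.
Qed.

Definition pm_basis (n : nat) : pm_lmod := ('X^n : {poly F}).

Fact pm_basis_act n w :
  ract (pm_basis n) (@monomial F A w) =
  path_coef lam n w *: 'X^(n + size w) :> {poly F}.
Proof. by rewrite /monomial pm_ractE /word free_actU scale1r word_actXn. Qed.

Fact pm_linesP n (v : pm_lmod) :
  Fline (pm_basis n) v <-> exists c, v = c *: 'X^n :> {poly F}.
Proof.
split=> [[c _ <-]|[c vE]]; exists c => //; first by rewrite pm_ract_alg.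
by rewrite pm_ract_alg vE.
Qed.

Fact pm_basis_point : point_module (fun n => Fline (pm_basis n)).
Proof.
have sumE N (x : nat -> pm_lmod) (c : nat -> F) :
    (forall n, x n = c n *: 'X^n :> {poly F}) ->
    \sum_(n < N) x n = \sum_(n < N) c n *: 'X^n :> {poly F}.
  by move=> xE; apply: eq_bigr => n _; rewrite xE.
split.
- move=> n; exists (pm_basis n) => //.
  by apply/eqP => /(congr1 (fun v : {poly F} => v`_n)) /eqP;
    rewrite coefXn eqxx coef0 oner_eq0.
- move=> v; exists (size (v : {poly F})), (fun n => (v : {poly F})`_n *: 'X^n).
  split=> [n|]; first by apply/pm_linesP; eexists.
  by apply: etrans (esym (coefK (v : {poly F}))) _; rewrite poly_def.
- move=> N x xE; have /choice[c cE] : forall n, exists c, x n = c *: 'X^n :> {poly F}.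
    by move=> n; apply/pm_linesP.
  move=> s0 n ltnN; rewrite cE.
  have := etrans (esym (sumE N _ _ cE)) s0; rewrite -poly_def.
  move=> /(congr1 (fun v : {poly F} => v`_n)).
  by rewrite coef_poly ltnN coef0 => ->; rewrite scale0r.
- move=> n k v f /pm_linesP[c vE] fk; apply/pm_linesP.
  rewrite pm_ractE vE free_actE.
  have -> : \sum_(w <- monalg.msupp f)
      monalg.mcoeff w f *: word_act w (c *: 'X^n) =
    \sum_(w <- monalg.msupp f)
      (monalg.mcoeff w f * c * path_coef lam n w) *: 'X^(n + k).
    rewrite big_seq [RHS]big_seq; apply: eq_bigr => w wf.
    have := word_act_sum w [:: c] id (fun=> 'X^n).
    by rewrite !big_seq1 => ->; rewrite word_actXn (fk _ wf) !scalerA.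
  by rewrite -scaler_suml; eexists.
- exists (pm_basis 0); first by apply/pm_linesP; exists 1; rewrite scale1r.
  have /choice[j lamj] : forall i, exists j, lam i 0 j != 0.
    by move=> i; have /rV0Pn := lam_neq0 i.
  pose wd n := map j (iota 0 n).
  have wdE n i : path_coef lam i (map j (iota i n)) != 0.
    by elim: n i => [|n IHn] i /=; rewrite ?oner_eq0 // mulf_neq0.
  move=> w; pose q := w : {poly F}.
  exists (\sum_(n < size q) (q`_n / path_coef lam 0 (wd n)) *:
     @monomial F A (wd n)).
  rewrite /ract scaler_suml; apply/esym; rewrite -[RHS](coefK q) poly_def.
  apply: eq_bigr => n _.
  rewrite -[_ *: monomial _]mulr_algr -/(ract _ _) ractM pm_ract_alg.
  rewrite pm_basis_act scalerA divfK; last exact: wdE.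
  by rewrite add0n size_map size_iota.
Qed.

Fact path_coef_point (p : nat -> proj_space F m) :
  (forall i, hcoord (p i) (lam i)) -> point_seqs A p.
Proof.
move=> plam; exists pm_lmod, (fun n => Fline (pm_basis n)).
split; first exact: pm_basis_point.
exists pm_basis, lam; split=> // [i|i j]; last first.
  by rewrite pm_basis_act pm_ract_alg /= mulr1 addn1.
split=> //; apply/eqP => /(congr1 (fun v : {poly F} => v`_i)) /eqP.
by rewrite coefXn eqxx coef0 oner_eq0.
Qed.

End Sufficient.

Fact point_seqs_supp (p p' : nat -> proj_space F m) (lam lam' : nat -> 'rV_m) :
  (forall i, hcoord (p i) (lam i)) -> (forall i, hcoord (p' i) (lam' i)) ->
  (forall i j, lam' i 0 j != 0 -> lam i 0 j != 0) ->
  point_seqs A p -> point_seqs A p'.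
Proof.
move=> plam plam' ll' /point_seqs_path_coef /(_ plam) lam_rel.
apply: (path_coef_point (lam := lam')) => // [i|w w0 i].
  exact: hcoord_neq0 (plam' i).
by apply: contra_eq (lam_rel w w0 i); exact: path_coef_supp.
Qed.

End PointModules.

Fact mcoord_exists (F : closedFieldType) k m (x : mproj F k m) : exists M : 'M[F]_(k, m), mcoord x M.
Proof.
have /choice[v xv] : forall i, exists v, hcoord (x i) v.
  by move=> i; exact: hcoord_exists.
by exists (\matrix_i v i) => i; rewrite rowK.
Qed.

Section PointVariety.
Variables (F : closedFieldType) (A : monomial_algebra F).
Let m := ngens A.

Definition truncate (n : nat) (p : nat -> proj_space F m) : mproj F n.+1 m :=
  [ffun i : 'I_n.+1 => p i].

Definition pointn_set (n : nat) : set (mproj F n.+1 m) :=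
  [set truncate n p | p in point_seqs A].

(* Membership only depends on the supports of the coordinate vectors, and is
   inherited by smaller supports. *)
Fact pointn_set_supp n (x y : mproj F n.+1 m) (M N : 'M[F]_(n.+1, m)) :
  mcoord x M -> mcoord y N -> (forall i j, N i j != 0 -> M i j != 0) ->
  pointn_set x -> pointn_set y.
Proof.
move=> xM yN MN [p Ap px].
have /choice[lam plam] : forall i, exists v, hcoord (p i) v.
  by move=> i; exact: hcoord_exists.
pose ext T (a : 'I_n.+1 -> T) (b : nat -> T) (i : nat) :=
  if insub i is Some i' then a i' else b i.
exists (ext _ y p); last first.
  by apply/ffunP => i; rewrite ffunE /ext valK.
refine (@point_seqs_supp F A p (ext _ y p) (ext _ (fun i0 => row i0 M) lam)
  (ext _ (fun i0 => row i0 N) lam) _ _ _ Ap) => i; rewrite /ext.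
- by case: insubP => // i' _ <-; move: (xM i'); rewrite -px ffunE.
- by case: insubP => // i' _ _; exact: yN.
- by move=> j; case: insubP => // i' _ _; rewrite !mxE; exact: MN.
Qed.

(* A point outside the set is separated from it by the product of the variables
   that do not vanish at it. *)
Fact pointn_set_closed n : zariski_closed (pointn_set (n := n)).
Proof.
exists [set q | (exists d, multihomog d q) /\
  forall y, pointn_set y -> forall N, mcoord y N -> mxeval N q = 0].
  by move=> q [].
apply/seteqP; split=> [x Vx q [_ qV] M xM|x x0]; first exact: qV xM.
apply: contrapT => nVx; have [M xM] := mcoord_exists x.
pose mm := [multinom (mxvec M 0%R v != 0%R : nat) | v < n.+1 * m].
have q0 : mxeval M 'X_[mm] = 0.
  apply: (x0 _ _ M xM); split=> [|y Vy N yN].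
    exists (fun i => \sum_(j < m) mm (mxvec_index i j))%N => mm'.
    by rewrite msuppX inE => /eqP -> i.
  rewrite /mxeval mevalX.
  have [i [j [Mij Nij]]] : exists i j, M i j != 0 /\ N i j = 0.
    apply: contrapT => nMN; apply: nVx.
    apply: (pointn_set_supp yN xM _ Vy) => i j Mij.
    by apply/eqP => Nij; apply: nMN; exists i, j.
  rewrite (bigD1 (mxvec_index i j)) //= mxvecE Nij mnmE mxvecE Mij.
  by rewrite expr1 mul0r.
suff : mxeval M 'X_[mm] != 0 by rewrite q0 eqxx.
rewrite /mxeval mevalX; apply/prodf_neq0 => v _; rewrite mnmE.
by have [_|] := eqVneq (mxvec M 0 v) 0; rewrite /= ?expr0 ?oner_eq0.
Qed.

Definition pointn (n : nat) : variety F := Variety (pointn_set_closed n).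

End PointVariety.

Section ForgetFactors.
Variables (F : closedFieldType) (k k' m : nat) (s : 'I_k -> 'I_k').
Hypothesis s_inj : injective s.

Definition pull_mnm (mm : multinom (k * m)) : multinom (k' * m) :=
  [multinom (\sum_(i < k) \sum_(j < m)
     (mxvec_index (s i) j == u) * mm (mxvec_index i j))%N | u < k' * m].

Definition pull_poly (q : mpoly (k * m) F) : mpoly (k' * m) F :=
  \sum_(mm <- msupp q) q@_mm *: 'X_[pull_mnm mm].

Fact mxvec_index_inj (a b : nat) (i i' : 'I_a) (j j' : 'I_b) :
  mxvec_index i j = mxvec_index i' j' -> i = i' /\ j = j'.
Proof. by move=> /cast_ord_inj /enum_rank_inj [-> ->]. Qed.

Fact prod_mxvec_index (a b : nat) (G : 'I_(a * b) -> F) :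
  \prod_u G u = \prod_i \prod_j G (mxvec_index i j).
Proof.
rewrite pair_bigA /= (reindex _ (curry_mxvec_bij _ _)) /=.
by apply: eq_bigr => -[].
Qed.

Fact pull_mnm_eval (M : 'M[F]_(k', m)) mm :
  mxeval M 'X_[pull_mnm mm] = mxeval (rowsub s M) 'X_[mm].
Proof.
rewrite /mxeval !mevalX [RHS]prod_mxvec_index.
under [LHS]eq_bigr => u _ do rewrite /pull_mnm mnmE expr_sum.
rewrite exchange_big; apply: eq_bigr => i _.
under [LHS]eq_bigr => u _ do rewrite expr_sum.
rewrite exchange_big; apply: eq_bigr => j _.
rewrite (bigD1 (mxvec_index (s i) j)) //= big1 => [|u /negPf].
  by rewrite eqxx mul1n mulr1 !mxvecE mxE.
by rewrite eq_sym => ->; rewrite mul0n expr0.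
Qed.

Fact pull_poly_eval (M : 'M[F]_(k', m)) q :
  mxeval M (pull_poly q) = mxeval (rowsub s M) q.
Proof.
rewrite [in RHS](mpolyE q) /mxeval /pull_poly !raddf_sum /=.
apply: eq_bigr => mm _; rewrite !mevalZ; congr (_ * _).
exact: pull_mnm_eval.
Qed.

Definition pull_deg (d : 'I_k -> nat) (i' : 'I_k') : nat :=
  (\sum_(i < k | s i == i') d i)%N.

Fact pull_poly_multihomog d q :
  multihomog d q -> multihomog (pull_deg d) (pull_poly q).
Proof.
move=> qd mm; rewrite /pull_deg.
move=> /msupp_sum_le /flatten_mapP[mm0]; rewrite filter_predT => mm0q.
move=> /msuppZ_le; rewrite msuppX inE => /eqP -> i'.
under [LHS]eq_bigr => j _ do rewrite /pull_mnm mnmE.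
rewrite exchange_big [RHS]big_mkcond; apply: eq_bigr => i _.
rewrite -(qd _ mm0q) exchange_big /=; case: eqP => [<-|nsi].
  apply: eq_bigr => j _; rewrite (bigD1 j) //= eqxx mul1n big1 ?addn0 //.
  by move=> j' nj; case: eqP => [/mxvec_index_inj[_ e]|//]; rewrite e eqxx in nj.
rewrite big1 // => j _; rewrite big1 // => j' _.
by case: eqP => [/mxvec_index_inj[]|].
Qed.

Fact rowsub_mcoord (x : mproj F k' m) (y : mproj F k m) (M : 'M[F]_(k', m)) :
  (forall i, y i = x (s i)) -> mcoord x M -> mcoord y (rowsub s M).
Proof. by move=> yx xM i; rewrite yx row_rowsub. Qed.

Fact extend_mcoord (x : mproj F k' m) (y : mproj F k m) (N : 'M[F]_(k, m)) :
  (forall i, y i = x (s i)) -> mcoord y N ->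
  exists2 M, mcoord x M & N = rowsub s M.
Proof.
move=> yx yN; have [M xM] := mcoord_exists x.
exists (\matrix_i' if [pick i | s i == i'] is Some i then row i N
                   else row i' M).
  move=> i'; rewrite rowK; case: pickP => [i /eqP <-|_]; last exact: xM.
  by rewrite -yx; exact: yN.
apply/row_matrixP => i; rewrite row_rowsub rowK.
by case: pickP => [i0 /eqP /s_inj -> //|/(_ i)]; rewrite eqxx.
Qed.

Fact forget_morphism (VX : set (mproj F k' m)) (VY : set (mproj F k m))
    (cX : zariski_closed VX) (cY : zariski_closed VY)
    (X := Variety cX) (Y := Variety cY) (f : X -> Y) :
  (forall x i, val (f x) i = val x (s i)) -> vmorphism f.
Proof.
move=> fE.
have closed_pre (Z : set Y) : vclosed Z -> vclosed (f @^-1` Z).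
  case=> C [S Sh CE] ZE; exists (zero_locus (pull_poly @` S)).
    by exists (pull_poly @` S) => // _ [q Sq <-]; have [d qd] := Sh q Sq;
      exists (pull_deg d); exact: pull_poly_multihomog.
  rewrite ZE CE; apply/seteqP; split=> x /= x0.
    move=> _ [q Sq <-] M xM; rewrite pull_poly_eval; apply: (x0 q Sq).
    exact: rowsub_mcoord (fE x) xM.
  move=> q Sq N yN; have [M xM ->] := extend_mcoord (fE x) yN.
  by rewrite -pull_poly_eval; apply: x0 => //; exists q.
split=> // U h Uo hreg x Ufx; have [O [Oo Ofx [d [q [r [qd rd hE]]]]]] := hreg _ Ufx.
exists (f @^-1` O); split=> //; first by rewrite /vopen preimage_setC; exact: closed_pre.
exists (pull_deg d), (pull_poly q), (pull_poly r).
split=> [||y Oy Uy M yM]; try exact: pull_poly_multihomog.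
by rewrite !pull_poly_eval; apply: hE => //; exact: rowsub_mcoord (fE y) yM.
Qed.

End ForgetFactors.

Section PointProalgebraic.
Variables (F : closedFieldType) (A : monomial_algebra F).

Definition drop_last (n : nat) (x : mproj F n.+2 (ngens A)) :
    mproj F n.+1 (ngens A) :=
  [ffun i => x (widen_ord (leqnSn n.+1) i)].

Fact drop_last_truncate n p : drop_last (truncate n.+1 p) = truncate n p.
Proof. by apply/ffunP => i; rewrite !ffunE. Qed.

Fact drop_last_pointn n (x : pointn A n.+1) :
  drop_last (val x) \in (pointn A n : set _).
Proof.
by rewrite inE; have [p Ap <-] := set_valP x; exists p; rewrite ?drop_last_truncate.
Qed.

Definition pointn_map n (x : pointn A n.+1) : pointn A n :=
  SigSub (drop_last_pointn x).

Fact pointn_map_morphism n : vmorphism (@pointn_map n).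
Proof.
apply: (@forget_morphism _ _ _ _ (widen_ord (leqnSn n.+1))) => [i j|x i].
  by move=> /(congr1 val) /= /val_inj.
by rewrite ffunE.
Qed.

Fact pointn_map_surj n (y : pointn A n) : exists x, pointn_map x = y.
Proof.
have [p Ap py] := set_valP y.
have xP : truncate n.+1 p \in (pointn A n.+1 : set _) by rewrite inE; exists p.
by exists (SigSub xP); apply: val_inj; rewrite /= drop_last_truncate.
Qed.

Definition point_variety : proalgebraic F :=
  Proalgebraic pointn_map_morphism pointn_map_surj.

End PointProalgebraic.

(* Main.v *)
Require Import Defs.
From HB Require Import structures.
From mathcomp Require Import all_boot all_order all_algebra.
From mathcomp Require Import mpoly.
From mathcomp Require Import boolp classical_sets functions.

Set Implicit Arguments.
Unset Strict Implicit.
Unset Printing Implicit Defensive.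

Import GRing.Theory.
Local Open Scope classical_set_scope.
Local Open Scope ring_scope.

(* Let L be the language of non-zero words of A. The n-truncated points form the
   union of the products of coordinate subspaces P(T_0) x ... x P(T_n) such that
   T_0 ... T_n is contained in L. If it is irreducible it is one of these
   products, so L consists of the words w with w_i in S_i for a sequence of sets
   of letters which decreases, because L is closed under taking suffixes. Let
   S_i = S for i >= N. The letters outside S only occur in the first N positions
   of a word of L, so killing them maps A onto F<S> and the product of N+1
   elements of the kernel is zero.

   In (ii), let f and g be the inverse morphisms between the products of the
   P(S_i) and of copies of P^(d-1). Over the factorial polynomial rings, a
   morphism from a product of projective spaces to a projective space is given
   by a tuple of multihomogeneous polynomials without common zero, hence has a
   multidegree. If |S_i| >= 2, restrict f to the i-th factor: the degrees e_j of
   the components of f and e'_j of the i-th component of g satisfy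
   sum_j e_j e'_j = 1, so some e_j = e'_j = 1. Both maps are then linear and
   injective, and |S_i| = d. If |S_i| = 1 < d for some i, then the values of g
   only depend on finitely many coordinates, which contradicts injectivity. So
   all S_i have d elements, the sequence is constant, and A is free. *)

(** * Factoriality of polynomial rings *)

(** Vanishing of the 2 by 2 minors: over a domain and for non-zero tuples, equality of points of the
    projective space over the fraction field, stated without fractions. *)
Definition proportional (R : nzRingType) (I : Type) (G H : I -> R) :=
  forall i j, G i * H j = G j * H i.

(** Over a factorial ring, a non-zero tuple has this property exactly when its entries have no
    common factor but units; no gcd or irreducible element is mentioned. *)
Definition primitive (R : nzRingType) (I : Type) (H : I -> R) :=
  forall G, proportional G H -> exists h, forall i, G i = h * H i.

(** The consequence of factoriality on which the study of morphisms rests. The index [i0] keeps the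
    tuples away from zero, as the zero tuple is proportional to every tuple. *)
Definition has_primitives (R : nzRingType) :=
  forall (I : finType) (G : I -> R) i0, G i0 != 0 ->
  exists H, [/\ proportional G H, primitive H & H i0 != 0].

Section Proportional.
Variables (R : idomainType) (I : Type).
Implicit Types G H K : I -> R.

Lemma proportional_trans H G K i0 : H i0 != 0 ->
  proportional G H -> proportional H K -> proportional G K.
Proof.
move=> H0 GH HK i j; apply: (mulfI H0).
by rewrite mulrCA mulrA GH -mulrA HK mulrA -GH -mulrA mulrCA.
Qed.

End Proportional.

Lemma field_has_primitives (F : fieldType) : has_primitives F.
Proof.
move=> I G i0 G0; exists G; split=> // [i j|G' G'G]; first exact: mulrC.
by exists (G' i0 / G i0) => i; rewrite mulrAC G'G mulfK.
Qed.

Lemma has_primitives_iso (R S : idomainType) (f : {rmorphism R -> S}) :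
  bijective f -> has_primitives S -> has_primitives R.
Proof.
move=> [g fK gK] Sprim I G i0 G0.
have finj := can_inj fK.
have [|H [GH Hprim H0]] := Sprim I (f \o G) i0.
  by rewrite /= -(rmorph0 f) (inj_eq finj).
exists (g \o H); split=> /= [i j||].
- by apply: finj; rewrite !rmorphM !gK; exact: GH.
- move=> G' G'H; have [|h hE] := Hprim (f \o G').
    by move=> i j /=; have := congr1 f (G'H i j); rewrite !rmorphM /= !gK.
  by exists (g h) => i; apply: finj; rewrite rmorphM /= !gK; exact: hE.
- by apply: contra_neq H0 => /(congr1 f); rewrite gK rmorph0.
Qed.

Section PolyPrimitives.
Variable R : idomainType.

(** The Bezout relation over the fraction field with denominators cleared: a non-zero [g] of least
    size in the ideal generated by the [P i] divides a constant multiple of each [P i], and the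
    quotients generate an ideal containing a non-zero constant. *)
Lemma proportional_bezout (I : finType) (P : I -> {poly R}) i0 : P i0 != 0 ->
  exists (Q U : I -> {poly R}) (c : R),
    [/\ proportional P Q, Q i0 != 0, c != 0 & \sum_i U i * Q i = c%:P].
Proof.
move=> P0; pose J f := exists U, f = \sum_i U i * P i.
pose J_size n := `[< exists f, [/\ J f, f != 0 & size f = n] >].
have exJ : exists n, J_size n.
  exists (size (P i0)); apply/asboolP; exists (P i0); split=> //.
  exists (fun i => (i == i0)%:R); rewrite (bigD1 i0) //= eqxx mul1r big1 ?addr0 //.
  by move=> i /negPf ->; rewrite mul0r.
case: (ex_minnP exJ) => n /asboolP[g [[U gE] g0 <-]] gmin.
pose a i := lead_coef g ^+ scalp (P i) g.
have a0 i : a i != 0 by rewrite expf_neq0 // lead_coef_eq0.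
(* The pseudo-remainder lies in the ideal and is smaller than [g], so it is zero. *)
have aP i : a i *: P i = (P i %/ g) * g.
  have aPE := Pdiv.WeakIdomain.divp_eq (P i) g.
  suff r0 : P i %% g = 0 by rewrite [LHS]aPE r0 addr0.
  apply/eqP; apply: contraT => r0.
  have : J_size (size (P i %% g)).
    apply/asboolP; exists (P i %% g); split=> //.
    exists (fun j => (a i *+ (j == i))%:P - (P i %/ g) * U j).
    under eq_bigr => j _ do rewrite mulrBl -mulrA.
    rewrite sumrB -mulr_sumr -gE (bigD1 i) //= eqxx mulr1n big1 ?addr0.
      by rewrite mul_polyC /a aPE addrC addKr.
    by move=> j /negPf ->; rewrite mulr0n mul0r.
  by move=> /gmin; rewrite leqNgt Pdiv.Idomain.ltn_modp g0.
pose c := \prod_i a i.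
have c0 : c != 0 by apply/prodf_neq0.
(* The remaining factors of [c] give all quotients the same multiplier: [c *: P i = Q i * g]. *)
pose Q i := (\prod_(j | j != i) a j) *: (P i %/ g).
have cP i : c *: P i = Q i * g.
  by rewrite /c (bigD1 i) //= mulrC -scalerA aP scalerAl.
exists Q, U, c; split=> //.
- move=> i j; apply: (mulIf g0).
  by rewrite -!mulrA -!cP -!scalerAr [P i * _]mulrC.
- apply: contraNneq P0 => Q0; have /eqP := cP i0.
  by rewrite Q0 mul0r scale_poly_eq0 (negPf c0).
- apply: (mulIf g0); rewrite mulr_suml.
  under eq_bigr => i _ do rewrite -mulrA -cP -scalerAr.
  by rewrite -scaler_sumr -gE mul_polyC.
Qed.

Definition pdivides (c : R) (p : {poly R}) := exists q, p = c *: q.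

Lemma pdividesP c (p : {poly R}) : (forall k, exists r, p`_k = c * r) <-> pdivides c p.
Proof.
split=> [/choice[r rE]|[q ->] k]; last by exists q`_k; rewrite coefZ.
exists (\poly_(k < size p) r k); apply/polyP => k; rewrite coefZ coef_poly rE.
by case: ltnP => // le_pk; rewrite mulr0 -rE nth_default.
Qed.

Lemma pdividesB c p q : pdivides c p -> pdivides c q -> pdivides c (p - q).
Proof. by move=> [p' ->] [q' ->]; exists (p' - q'); rewrite scalerBr. Qed.

Lemma pdividesD c p q : pdivides c p -> pdivides c q -> pdivides c (p + q).
Proof. by move=> [p' ->] [q' ->]; exists (p' + q'); rewrite scalerDr. Qed.

Lemma pdividesMr c p q : pdivides c p -> pdivides c (p * q).
Proof. by move=> [p' ->]; exists (p' * q); rewrite scalerAl. Qed.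

(* As in McCoy's theorem on zero divisors of [(R/c)[X]]: by induction on the
   size, [c] divides the products of [h] with each coefficient of each [H j]. *)
Lemma gauss_divides (I : Type) (H : I -> {poly R}) (c : R) (h : {poly R}) :
  (forall y, (forall j k, exists r, y * (H j)`_k = c * r) ->
     exists r, y = c * r) ->
  (forall j, pdivides c (h * H j)) -> pdivides c h.
Proof.
move=> Hprim; have [n] := ubnP (size h); elim: n h => // n IHn h hn hH.
have hHk j : forall k, pdivides c ((H j)`_k *: h).
  suff : forall s k, (size (H j) <= k + s)%N -> pdivides c ((H j)`_k *: h).
    by move=> down k; apply: (down (size (H j))); rewrite leq_addl.
  elim=> [|s IHs] k le_k.
    by exists 0; rewrite nth_default ?scale0r ?scaler0 // -[k]addn0.
  (* By the descending induction on [k], the coefficients of [H j] above [k] only contribute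
     multiples of [c] to [h * H j]. *)
  have top r : pdivides c (h * drop_poly k.+1 (H j) * 'X^r).
    apply: pdividesMr; rewrite -[drop_poly _ _]coefK poly_def mulr_sumr.
    apply: (big_ind (pdivides c)) => [|p q|i _].
    - by exists 0; rewrite scaler0.
    - exact: pdividesD.
    rewrite -scalerAr scalerAl; apply: pdividesMr; rewrite coef_drop_poly.
    by apply: IHs; rewrite (leq_trans le_k) // addnS -addSn leq_add2r leq_addl.
  (* The coefficient of index [k + (size h).-1] of this product is the leading coefficient of [h]
     times the coefficient of index [k] of [H j]. *)
  have low : pdivides c (h * take_poly k.+1 (H j)).
    rewrite -[take_poly _ _](addrK (drop_poly k.+1 (H j) * 'X^(k.+1))).
    rewrite poly_take_drop mulrBr; apply: pdividesB; first exact: hH.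
    by rewrite mulrA; apply: top.
  have [h0|h0] := eqVneq h 0; first by exists 0; rewrite h0 !scaler0.
  (* [h'] is [b *: h] without its leading term; it inherits the divisibility hypothesis and is
     smaller than [h], so [c] divides it. *)
  set b := (H j)`_k; set h' := b *: h - (b * lead_coef h) *: 'X^((size h).-1).
  have cbh : pdivides c ((b * lead_coef h) *: 'X^((size h).-1)).
    have /pdividesP /(_ (k + (size h).-1)%N) [r] := low.
    have lt_h : ((size h).-1 < (k + (size h).-1).+1)%N by rewrite ltnS leq_addl.
    rewrite coefM (bigD1 (Ordinal lt_h)) //= addnK coef_take_poly ltnSn.
    rewrite big1 ?addr0 => [hbE|i].
      by exists (r *: 'X^((size h).-1)); rewrite scalerA -hbE mulrC.
    rewrite -val_eqE /= neq_ltn => /orP[lt_i|gt_i]; last first.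
      by rewrite nth_default ?mul0r // (leq_trans (leqSpred _) gt_i).
    rewrite coef_take_poly ltnS leqNgt ltn_subRL.
    by rewrite [(i + k)%N]addnC ltn_add2l lt_i mulr0.
  have : pdivides c h'.
    apply: IHn => [|i].
      have szh : (0 < size h)%N by rewrite size_poly_gt0.
      apply: (@leq_ltn_trans (size h).-1); last by rewrite prednK // -ltnS.
      apply/leq_sizeP => l le_l; rewrite coefB !coefZ coefXn.
      have [->|nl] := eqVneq l (size h).-1; first by rewrite mulr1 subrr.
      rewrite mulr0 subr0 nth_default ?mulr0 // -(prednK szh).
      by rewrite ltn_neqAle eq_sym nl.
    rewrite mulrBl; apply: pdividesB; last exact: pdividesMr.
    by rewrite -scalerAl; case: (hH i) => q ->; exists (b *: q); rewrite !scalerA mulrC.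
  by move=> /pdividesD /(_ cbh); rewrite /h' subrK.
apply/pdividesP => l; apply: Hprim => j k.
by have /pdividesP /(_ l) [r rE] := hHk j k; exists r; rewrite -rE coefZ mulrC.
Qed.

(** The tuple is first replaced by one with a Bezout relation, then the family of all its
    coefficients by a primitive one over [R]; this gives [K]. If [G] is proportional to [K], the
    relation yields [c' *: G j = h * K j], and [gauss_divides] shows that the constant [c'] divides
    [h]. *)
Lemma poly_has_primitives : has_primitives R -> has_primitives {poly R}.
Proof.
move=> Rprim I P i0 P0.
have [Q [U [c [PQ Q0 c0 UQ]]]] := proportional_bezout P0.
pose N := \max_i size (Q i).
have ltN i k : (Q i)`_k != 0 -> (k < N)%N.
  move=> nz; apply: leq_trans (leq_bigmax (F := fun i => size (Q i)) i).
  by rewrite ltnNge; apply: contra nz => le; rewrite nth_default.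
pose coefs (H : I -> {poly R}) (ik : I * 'I_N) := (H ik.1)`_ik.2.
have lead0 : (Q i0)`_(size (Q i0)).-1 != 0 by rewrite -/(lead_coef _) lead_coef_eq0.
pose k0 := Ordinal (ltN _ _ lead0).
have [H [QH Hprim H0]] := Rprim _ (coefs Q) (i0, k0) lead0.
pose K i := \poly_(k < N) (if insub k is Some k' then H (i, k') else 0).
have KE i (k : 'I_N) : (K i)`_k = H (i, k) by rewrite coef_poly ltn_ord valK.
have KN i k : (N <= k)%N -> (K i)`_k = 0 by move=> le; rewrite coef_poly ltnNge le.
pose a := (Q i0)`_k0; pose b := H (i0, k0).
have bQ i : b *: Q i = a *: K i.
  apply/polyP => k; rewrite !coefZ; case: (ltnP k N) => [lt|le]; last first.
    rewrite KN // mulr0; apply/eqP; rewrite mulf_eq0; apply/orP; right.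
    by apply: contraTT le => /ltN; rewrite -ltnNge.
  rewrite mulrC (KE i (Ordinal lt)).
  exact: (QH (i, Ordinal lt) (i0, k0)).
have K0 : K i0 != 0 by apply: contraNneq H0 => K0; rewrite -KE K0 coef0.
have QK : proportional Q K.
  move=> i j; apply: (@mulfI _ b%:P); first by rewrite polyC_eq0.
  rewrite !mulrA !mul_polyC !bQ -!scalerAl; congr (_ *: _); exact: mulrC.
exists K; split=> //; first exact: proportional_trans Q0 PQ QK.
move=> G GK; pose c' := b * c; pose h := a *: \sum_i U i * G i.
have c'0 : c' != 0 by rewrite mulf_neq0.
have aUK : a *: \sum_i U i * K i = c'%:P.
  rewrite scaler_sumr; under eq_bigr => i _ do rewrite scalerAr -bQ -scalerAr.
  by rewrite -scaler_sumr UQ -mul_polyC -polyCM.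
have hK j : h * K j = c' *: G j.
  rewrite -scalerAl mulr_suml; under eq_bigr => i _ do rewrite -mulrA GK mulrCA.
  by rewrite -mulr_sumr scalerAr aUK mulrC mul_polyC.
have [q hE] : pdivides c' h.
  apply: (gauss_divides (H := K)) => [y yK|j]; last by exists (G j).
  have /choice[r rE] : forall ik, exists r, y * H ik = c' * r.
    by move=> [i k]; rewrite -KE; apply: yK.
  (* If [c'] divides [y] times every coefficient, the quotients form a tuple proportional to [H],
     hence [z] times [H] for some [z], and [y = c' * z]. *)
  have [|z zE] := Hprim r.
    move=> i j; apply: (mulfI c'0); rewrite !mulrA -!rE -!mulrA; congr (_ * _).
    exact: mulrC.
  by exists z; apply: (mulIf H0); rewrite rE zE mulrA.
exists q => j; apply: (@mulfI _ c'%:P); first by rewrite polyC_eq0.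
by rewrite mulrA !mul_polyC -hE hK.
Qed.

End PolyPrimitives.

Section MuniBijective.
Variables (R : comNzRingType) (n : nat).

(** The inverse of [muni], which reads a polynomial in [n.+1] variables as one in the last variable;
    along it primitive tuples are obtained by induction on [n]. *)
Definition from_muni : {poly {mpoly R[n]}} -> {mpoly R[n.+1]} :=
  horner_eval 'X_ord_max \o map_poly (@mwiden n R).

HB.instance Definition _ := GRing.RMorphism.on from_muni.

Lemma from_muniZX c i : from_muni (c *: 'X^i) = mwiden c * 'X_ord_max ^+ i.
Proof.
by rewrite /from_muni /= map_polyZ /horner_eval hornerZ map_polyXn hornerXn.
Qed.

Lemma muniX (mm : 'X_{1..n.+1}) :
  muni 'X_[R, mm] =
  'X_[[multinom mm (widen_ord (leqnSn n) i) | i < n]] *: 'X^(mm ord_max).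
Proof. by rewrite muniE msuppX big_seq1 mcoeffX eqxx scale1r. Qed.

Lemma muniK : cancel (@muni n R) from_muni.
Proof.
move=> p; rewrite [in LHS](mpolyE p) [RHS](mpolyE p).
rewrite (raddf_sum (@muni n R)) (raddf_sum from_muni).
apply: eq_bigr => mm _;
  rewrite -[LHS]/(from_muni (muni _)) muniZ muniX scalerA /from_muni /=.
rewrite map_polyZ /horner_eval hornerZ map_polyXn hornerXn.
rewrite rmorphM /= mwidenC mwidenX -mulrA mul_mpolyC; congr (_ *: _).
rewrite mpolyXn -mpolyXD; congr 'X_[_]; apply/mnmP => i.
rewrite mnmDE mulmnE mnm1E; have [j ->|->] := unliftP ord_max i.
  have -> : lift ord_max j = widen_ord (leqnSn n) j by apply: val_inj; exact: lift_max.
  rewrite mnmwiden_widen mnmE -val_eqE /= gtn_eqF ?ltn_ord //.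
  by rewrite mul0n addn0.
by rewrite mnmwiden_ordmax eqxx mul1n.
Qed.

Lemma muni_mwiden (p : {mpoly R[n]}) : muni (mwiden p) = p%:P.
Proof.
rewrite [in LHS](mpolyE p) [in RHS](mpolyE p) (raddf_sum (@mwiden n R)).
rewrite (raddf_sum (@muni n R)) (raddf_sum (@polyC _)).
apply: eq_bigr => mm _; rewrite -[LHS]/(muni (mwiden _)) -[RHS]/(_%:P).
rewrite mwidenZ mwidenX muniZ muniX mnmwiden_ordmax expr0 scalerA.
rewrite alg_polyC mul_mpolyC; congr ((_ *: 'X_[_])%:P).
by apply/mnmP => i; rewrite mnmE mnmwiden_widen.
Qed.

Lemma from_muniK : cancel from_muni (@muni n R).
Proof.
move=> q; rewrite -[in LHS](coefK q) -[RHS]coefK !poly_def.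
rewrite (raddf_sum from_muni) (raddf_sum (@muni n R)).
apply: eq_bigr => i _; rewrite -[LHS]/(muni (from_muni _)).
rewrite from_muniZX muniM muni_mwiden mul_polyC (rmorphXn (@muni n R)).
congr (_ *: _ ^+ _); rewrite -[LHS]/(muni 'X_[_]) muniX mnmE eqxx expr1.
rewrite -[X in _ = X]scale1r; congr (_ *: _).
rewrite -mpolyX0; congr 'X_[_]; apply/mnmP => j; rewrite !mnmE -val_eqE /=.
by rewrite gtn_eqF ?ltn_ord.
Qed.

Lemma muni_bij : bijective (@muni n R).
Proof. by exists from_muni; [exact: muniK | exact: from_muniK]. Qed.

End MuniBijective.

Lemma mpoly_has_primitives (F : fieldType) n : has_primitives {mpoly F[n]}.
Proof.
elim: n => [|n IHn].
  apply: (has_primitives_iso (f := @mcoeff 0 F 0%MM)); last exact: field_has_primitives.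
  by exists (@mpolyC 0 F); [exact: mpolyKC | exact: mpolyCK].
exact: has_primitives_iso (muni_bij F n) (poly_has_primitives IHn).
Qed.

(** * Non-vanishing of polynomials at points *)

Section Evaluation.
Variable F : closedFieldType.

Lemma poly_neq0_eval (p : {poly F}) : p != 0 -> exists t, p.[t] != 0.
Proof. by move=> /closed_nonrootP. Qed.

Lemma from_muni_eval n (q : {poly {mpoly F[n]}}) (v : 'I_n.+1 -> F) :
  (from_muni q).@[v] =
  (map_poly (meval (fun i => v (widen_ord (leqnSn n) i))) q).[v ord_max].
Proof.
rewrite -[in LHS](coefK q) -[in RHS](coefK q) poly_def.
rewrite (raddf_sum (@from_muni F n)) raddf_sum raddf_sum horner_sum.
apply: eq_bigr => i _; rewrite -[LHS]/((from_muni _).@[v]) from_muniZX.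
rewrite -[RHS]/((map_poly (meval _) _).[_]) map_polyZ hornerZ map_polyXn hornerXn.
rewrite mevalM rmorphXn /= mevalXU; congr (_ * _).
rewrite [in LHS](mpolyE q`_i) [in RHS](mpolyE q`_i) (raddf_sum (@mwiden n F)).
rewrite (raddf_sum (meval v)) (raddf_sum (meval _)).
apply: eq_bigr => mm _; rewrite -[LHS]/((mwiden _).@[v]) -[RHS]/(_.@[_]).
rewrite mwidenZ mwidenX !mevalZ !mevalX big_ord_recr /= mnmwiden_ordmax mulr1.
by congr (_ * _); apply: eq_bigr => j _; rewrite mnmwiden_widen.
Qed.

(** Induction on the number of variables: the first [n] values avoid the zeros of the leading
    coefficient in the last variable, and the last value avoids the roots of the non-zero polynomial
    that results. *)
Lemma mpoly_neq0_eval n (p : {mpoly F[n]}) : p != 0 -> exists v, p.@[v] != 0.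
Proof.
elim: n p => [|n IHn] p p0.
  exists (fun=> 0); move: p0; rewrite [p]nvar0_mpolyC_eq // mevalC.
  by apply: contraNneq => ->; rewrite mpolyC0.
have q0 : muni p != 0 by rewrite -(muni0 n F) (can_eq (@muniK F n)).
have [v v0] : exists v, (lead_coef (muni p)).@[v] != 0.
  by apply: IHn; rewrite lead_coef_eq0.
have [|t t0] := @poly_neq0_eval (map_poly (meval v) (muni p)).
  apply: contraNneq v0 => /(congr1 (fun r : {poly F} => r`_(size (muni p)).-1)).
  by rewrite coef_map coef0 => <-.
exists (fun i => if unlift ord_max i is Some j then v j else t).
rewrite -(muniK p) from_muni_eval unlift_none.
rewrite [X in X.[_]](_ : _ = map_poly (meval v) (muni p)) //.
apply: eq_map_poly => r; apply: meval_eq => i.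
rewrite (_ : widen_ord _ i = lift ord_max i) ?liftK //.
by apply: val_inj; rewrite /= /bump leqNgt ltn_ord.
Qed.

End Evaluation.

(** * Multihomogeneous polynomials *)

(** While [D] is positive, zero is a root of one of the factors and an ['X] can be cancelled there,
    so both factors are monomials. The exponent of [q] is expressed by [p] and [D] alone, so that it
    is common to all cofactors of [p]. *)
Lemma monomial_factor (R : idomainType) (p q : {poly R}) c D :
  c != 0 -> p * q = c%:P * 'X^D ->
  exists v, q = v%:P * 'X^(D - (size p).-1).
Proof.
move=> c0; suff : p * q = c%:P * 'X^D -> exists a b u v,
    [/\ p = u%:P * 'X^a, q = v%:P * 'X^b & (a + b = D)%N].
  move=> mono pq; have [a [b [u [v [pE qE <-]]]]] := mono pq; exists v.
  have u0 : u != 0.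
    apply: contraNneq c0 => u0; have /eqP := pq.
    by rewrite pE u0 mul0r mul0r eq_sym mulf_eq0 expf_eq0 polyX_eq0 andbF orbF
      polyC_eq0.
  rewrite qE; congr (_ * 'X^_); rewrite pE size_mul ?polyC_eq0 ?monic_neq0 ?monicXn //.
  by rewrite size_polyC u0 size_polyXn /= addKn.
elim: D p q => [|D IHD] p q.
  rewrite expr0 mulr1 => pq; have : size (p * q) == 1%N by rewrite pq size_polyC c0.
  rewrite size_mul_eq1 => /andP[/size_poly1P[u _ ->] /size_poly1P[v _ ->]].
  by exists 0%N, 0%N, u, v; rewrite expr0 !mulr1.
have XB : 'X - (0 : R)%:P = 'X by rewrite polyC0 subr0.
have divX (r : {poly R}) : root r 0 -> exists r', r = r' * 'X.
  by move=> /factor_theorem[r' ->]; exists r'; rewrite XB.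
move=> pq; have : root (p * q) 0 by rewrite pq rootE hornerM hornerXn expr0n mulr0.
have X0 : 'X != 0 :> {poly R} by rewrite polyX_eq0.
rewrite rootM => /orP[/divX[p' pE]|/divX[q' qE]].
  have [|a [b [u [v [p'E qE abD]]]]] := IHD p' q.
    by apply: (mulIf X0); rewrite mulrAC -pE pq exprSr mulrA.
  by exists a.+1, b, u, v; rewrite pE p'E exprSr mulrA addSn abD.
have [|a [b [u [v [pE q'E abD]]]]] := IHD p q'.
  by apply: (mulIf X0); rewrite -mulrA -qE pq exprSr mulrA.
by exists a, b.+1, u, v; rewrite qE q'E exprSr mulrA addnS abD.
Qed.

Section Weights.
Variables (F : fieldType) (n : nat) (wt : 'I_n -> nat).

Definition weight (mm : 'X_{1..n}) := (\sum_u wt u * mm u)%N.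

(** The substitution of [x_u T^(wt u)] for [x_u]: the coefficient of [T^D] is the part of weight
    [D]. *)
Definition weight_poly : {mpoly F[n]} -> {poly {mpoly F[n]}} :=
  mmap (@polyC _ \o @mpolyC n F) (fun u => ('X_u)%:P * 'X^(wt u)).

HB.instance Definition _ := GRing.RMorphism.on weight_poly.

Lemma weight_polyE p :
  weight_poly p = \sum_(mm <- msupp p) (p@_mm *: 'X_[mm])%:P * 'X^(weight mm).
Proof.
apply: eq_bigr => mm _ /=; rewrite -mul_mpolyC polyCM -mulrA; congr (_ * _).
rewrite /mmap1 mpolyXE_id rmorph_prod /= /weight expr_sum -big_split /=.
by apply: eq_bigr => u _; rewrite exprMn rmorphXn /= exprM.
Qed.

Lemma weight_poly_homog p D : (forall mm, mm \in msupp p -> weight mm = D) ->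
  weight_poly p = p%:P * 'X^D.
Proof.
move=> pD; rewrite weight_polyE [in RHS](mpolyE p) (raddf_sum (@polyC _)) mulr_suml.
by rewrite big_seq [RHS]big_seq; apply: eq_bigr => mm /pD ->.
Qed.

Lemma weight_poly_coef p D mm : ((weight_poly p)`_D)@_mm = p@_mm *+ (weight mm == D).
Proof.
rewrite weight_polyE coef_sum raddf_sum /=.
have [pmm|pmm] := boolP (mm \in msupp p); last first.
  rewrite (memN_msupp_eq0 pmm) mul0rn big_seq big1 // => mm' pmm'.
  rewrite coefCM coefXn mulr_natr mcoeffMn mcoeffZ mcoeffX.
  by case: eqP pmm' => [->|]; rewrite ?(negPf pmm) // mulr0 mul0rn.
rewrite (bigD1_seq mm) //= big1 ?addr0 => [|mm' /negPf nmm].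
  by rewrite coefCM coefXn mulr_natr mcoeffMn mcoeffZ mcoeffX eqxx mulr1 eq_sym.
by rewrite coefCM coefXn mulr_natr mcoeffMn mcoeffZ mcoeffX nmm mulr0 mul0rn.
Qed.

(** The images of [h] and [p] under [weight_poly] have a monomial in the new variable as product, so
    the image of [p] is a monomial too, with an exponent that only depends on [h] and [D]. *)
Lemma weight_factor (h : {mpoly F[n]}) D : h != 0 -> exists b, forall p,
  (forall mm, mm \in msupp (h * p) -> weight mm = D) ->
  forall mm, mm \in msupp p -> weight mm = b.
Proof.
move=> h0; exists (D - (size (weight_poly h)).-1)%N => p hpD mm pmm.
have p0 : p != 0 by apply: contraTneq pmm => ->; rewrite msupp0.
have [|v vE] := monomial_factor (mulf_neq0 h0 p0) (q := weight_poly p) (p :=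
  weight_poly h) (D := D).
  by rewrite -(rmorphM weight_poly) /= (weight_poly_homog hpD).
have := weight_poly_coef p (weight mm) mm; rewrite eqxx mulr1n vE coefCM coefXn.
have [//|_] := eqVneq; rewrite mulr0 mcoeff0 => /esym /eqP.
by rewrite mcoeff_eq0 pmm.
Qed.

End Weights.

Section Multihomog.
Variables (F : closedFieldType) (k m : nat).
Implicit Types (M : 'M[F]_(k, m)) (q : mpoly (k * m) F) (d : 'I_k -> nat).

Lemma multihomogM d d' q q' : multihomog d q -> multihomog d' q' ->
  multihomog (fun i => (d i + d' i)%N) (q * q').
Proof.
move=> qd qd' mm /msuppM_le /allpairsP[[m1 m2] /= [/qd m1d /qd' m2d ->]] i.
by rewrite -m1d -m2d -big_split; apply: eq_bigr => j _; rewrite mnmDE.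
Qed.

Lemma multihomog1 : multihomog (fun=> 0%N) (1 : mpoly (k * m) F).
Proof.
move=> mm; rewrite msupp1 inE => /eqP -> i.
by rewrite big1 // => j _; rewrite mnmE.
Qed.

Lemma multihomog_prod (I : Type) (r : seq I) (P : pred I) (d : I -> 'I_k -> nat)
    (q : I -> mpoly (k * m) F) :
  (forall l, multihomog (d l) (q l)) ->
  multihomog (fun i => \sum_(l <- r | P l) d l i)%N (\prod_(l <- r | P l) q l).
Proof.
move=> qd; elim: r => [|l r IHr].
  move=> mm; rewrite big_nil => mm1 i; rewrite big_nil; exact: multihomog1 mm1 i.
move=> mm; rewrite big_cons; case Pl: (P l) => mmq i; rewrite big_cons Pl.
  exact: (multihomogM (qd l) IHr mmq i).
exact: IHr.
Qed.

Lemma multihomogX u : multihomog (fun i => \sum_(j < m) (u == mxvec_index i j))%N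
  ('X_u : mpoly (k * m) F).
Proof.
move=> mm; rewrite msuppX inE => /eqP -> i.
by apply: eq_bigr => j _; rewrite mnm1E.
Qed.

(** For each row [i], the weight that counts the variables of this row is considered; [h] and [d]
    determine the weight of every cofactor, hence one [e] for all [l]. *)
Lemma multihomog_factor (I : Type) (h : mpoly (k * m) F) (H : I -> mpoly (k * m) F) d :
  h != 0 -> (forall l, multihomog d (h * H l)) ->
  exists e, forall l, multihomog e (H l).
Proof.
move=> h0 hH.
pose wt (i : 'I_k) (u : 'I_(k * m)) := (\sum_(j < m) (u == mxvec_index i j))%N.
have wtE i mm : weight (wt i) mm = (\sum_(j < m) mm (mxvec_index i j))%N.
  rewrite /weight; under eq_bigr => u _ do rewrite big_distrl.
  rewrite exchange_big; apply: eq_bigr => j _.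
  rewrite (bigD1 (mxvec_index i j)) //= eqxx mul1n big1 ?addn0 // => u /negPf ->.
  by rewrite mul0n.
have /choice[e eP] i := weight_factor (wt i) (d i) h0.
exists e => l mm Hmm i; rewrite -wtE; apply: eP Hmm => mm' hHmm.
by rewrite wtE; apply: hH hHmm i.
Qed.

Definition row_scale (c : 'I_k -> F) M : 'M_(k, m) := \matrix_(i, j) (c i * M i j).

Lemma mxeval_scale d q (c : 'I_k -> F) M : multihomog d q ->
  mxeval (row_scale c M) q = \prod_i c i ^+ d i * mxeval M q.
Proof.
move=> qd; rewrite /mxeval !mevalE mulr_sumr big_seq [RHS]big_seq.
apply: eq_bigr => mm qmm; rewrite mulrCA; congr (_ * _).
rewrite !prod_mxvec_index -big_split; apply: eq_bigr => i _ /=.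
rewrite -(qd _ qmm) expr_sum -big_split; apply: eq_bigr => j _ /=.
by rewrite !mxvecE mxE exprMn.
Qed.

Lemma hcoord_scaled (p : proj_space F m) v c : c != 0 -> hcoord p v -> hcoord p (c *:
  v).
Proof.
move=> c0 pv; rewrite /hcoord pv; apply/vspaceP => w.
apply/vlineP/vlineP => -[a ->]; first by exists (a / c); rewrite scalerA divfK.
by exists (a * c); rewrite scalerA.
Qed.

Lemma hcoord_proportional (p : proj_space F m) v w i j :
  hcoord p v -> hcoord p w -> v 0 i * w 0 j = v 0 j * w 0 i.
Proof.
by move=> pv pw; have [c _ ->] := hcoord_scale pv pw;
  rewrite !mxE mulrCA [RHS]mulrCA [v 0 i * _]mulrC.
Qed.

Lemma hcoord_of (v : 'rV[F]_m) : v != 0 -> exists p, hcoord p v.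
Proof.
move=> v0; have dv : \dim <[v]> == 1%N by rewrite dim_vline v0.
by exists (exist (fun L : {vspace 'rV[F]_m} => \dim L == 1%N) _ dv).
Qed.

Lemma hcoord_inj (p p' : proj_space F m) v : hcoord p v -> hcoord p' v -> p = p'.
Proof. by move=> pv pv'; apply: val_inj; rewrite pv pv'. Qed.

Lemma mcoord_of M : (forall i, row i M != 0) -> exists x, mcoord x M.
Proof.
move=> M0; have /choice[x xM] i := hcoord_of (M0 i).
by exists [ffun i => x i] => i; rewrite ffunE.
Qed.

(** Multiplied by one variable from each row, [q] also vanishes at the matrices with a zero row,
    hence everywhere. *)
Lemma mxeval_eq0 q : (0 < m)%N ->
  (forall M, (forall i, row i M != 0) -> mxeval M q = 0) -> q = 0.
Proof.
move=> m0 q0; pose X i : mpoly (k * m) F := 'X_(mxvec_index i (Ordinal m0)).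
have X0 : \prod_i X i != 0.
  by apply/prodf_neq0 => i _; rewrite -msupp_eq0 msuppX.
apply: contraTeq isT => qn0; have [v] := mpoly_neq0_eval (mulf_neq0 qn0 X0).
suff -> : (q * \prod_i X i).@[v] = 0 by rewrite eqxx.
have -> : (q * \prod_i X i).@[v] = mxeval (vec_mx (\row_u v u)) (q * \prod_i X i).
  by apply: meval_eq => u; rewrite vec_mxK mxE.
move: (vec_mx _) => M; rewrite /mxeval mevalM rmorph_prod /= -/(mxeval M q).
have [M0|] := pselect (forall i, row i M != 0); first by rewrite q0 ?mul0r.
move=> /existsNP[i /negP]; rewrite negbK => /eqP Mi.
rewrite (bigD1 i) //= mevalXU mxvecE; move/rowP: Mi => /(_ (Ordinal m0)).
by rewrite !mxE => ->; rewrite mul0r mulr0.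
Qed.

End Multihomog.

(** * Morphisms from products of projective spaces *)

Section Representation.
Variable F : closedFieldType.

Lemma mcoord_row_scale k m (x : mproj F k m) (M M' : 'M[F]_(k, m)) :
  mcoord x M -> mcoord x M' ->
  exists c, (forall i, c i != 0) /\ M' = row_scale c M.
Proof.
move=> xM xM'; have /choice[c cE] : forall i, exists c, c != 0 /\ row i M' = c *: row
  i M.
  by move=> i; have [c c0 cE] := hcoord_scale (xM i) (xM' i); exists c.
exists c; split=> [i|]; first by case: (cE i).
by apply/row_matrixP => i; case: (cE i) => _ ->; apply/rowP => j; rewrite !mxE.
Qed.

Lemma mcoord_eval_neq0 k m (x : mproj F k m) (M M' : 'M[F]_(k, m)) d q :
  multihomog d q -> mcoord x M -> mcoord x M' -> mxeval M q != 0 -> mxeval M' q != 0.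
Proof.
move=> qd xM xM' q0; have [c [c0 ->]] := mcoord_row_scale xM xM'.
rewrite (mxeval_scale _ _ qd) mulf_neq0 //.
by apply/prodf_neq0 => i _; rewrite expf_neq0.
Qed.

(** A point outside a closed set is separated from it by one of the defining polynomials: the
    complements of single hypersurfaces form a base of the topology. *)
Lemma vopen_basic (X : variety F) (O : set X) (x : X) : vopen O -> O x ->
  exists d p, [/\ multihomog d p,
    forall M, mcoord (val x) M -> mxeval M p != 0 &
    forall (y : X) M, mcoord (val y) M -> mxeval M p != 0 -> O y].
Proof.
case=> C [S Sh CE] OE Ox.
have : ~ C (val x).
  by move=> Cx; have : (~` O) x by rewrite OE.
rewrite CE /zero_locus /= => /existsNP[q /not_implyP[Sq /existsNP[M]]].
move=> /not_implyP[xM /eqP q0]; have [d qd] := Sh q Sq; exists d, q; split=> //.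
  by move=> M' xM'; exact: mcoord_eval_neq0 qd xM xM' q0.
move=> y M' yM' qM'; apply: contrapT => nOy.
have : [set x | C (val x)] y by rewrite -OE.
by rewrite CE => /(_ q Sq M' yM') qM'0; rewrite qM'0 eqxx in qM'.
Qed.

Variables (X Y : variety F) (f : X -> Y) (j : 'I_(nfactors Y)).
Hypothesis f_morph : vmorphism f.

Let X_ (l : 'I_(ncoords Y)) : mpoly _ F := 'X_(mxvec_index j l).

Let mxevalX (M : 'M[F]_(nfactors Y, ncoords Y)) l : mxeval M (X_ l) = row j M 0 l.
Proof. by rewrite /mxeval mevalXU mxvecE mxE. Qed.

Let X_homog l : multihomog (fun i => (j == i) : nat) (X_ l).
Proof.
move=> mm mmX i; rewrite (multihomogX mmX i).
have [<-|nji] := eqVneq j i.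
  rewrite (bigD1 l) //= eqxx big1 // => l' /negPf nl.
  by case: eqP => // /mxvec_index_inj[_ e]; rewrite e eqxx in nl.
by rewrite big1 // => l' _; case: eqP => // /mxvec_index_inj[e]; rewrite e eqxx in nji.
Qed.

Lemma chart_open l0 :
  vopen [set y : Y | forall w, hcoord (val y j) w -> w 0 l0 != 0].
Proof.
exists (zero_locus [set X_ l0]).
  by exists [set X_ l0] => // _ ->; exists (fun i => (j == i) : nat).
apply/seteqP; split=> y /=.
  move=> /existsNP[w /not_implyP[yw /negP]]; rewrite negbK => /eqP w0 _ -> M yM.
  have [c _ Mw] := hcoord_scale yw (yM j).
  by rewrite mxevalX Mw mxE w0 mulr0.
move=> /(_ _ (erefl _)) y0 nz; have [M yM] := mcoord_exists (val y).
by have := nz _ (yM j); rewrite -mxevalX y0 // eqxx.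
Qed.

(* In the chart where the coordinate [l0] of the [j]-th factor does not vanish,
   the quotients of the other coordinates by it are regular; their pullbacks
   are brought to a common denominator. *)
Lemma morphism_local (x : X) : exists p (G : 'I_(ncoords Y) -> mpoly _ F) d,
  [/\ forall l, multihomog d (G l),
      forall M, mcoord (val x) M -> mxeval M p != 0 &
      forall (y : X) M, mcoord (val y) M -> mxeval M p != 0 ->
        hcoord (val (f y) j) (\row_l mxeval M (G l))].
Proof.
have [v xv] := hcoord_exists (val (f x) j).
have /rV0Pn[l0 vl0] := hcoord_neq0 xv.
pose U : set Y := [set y : Y | forall w, hcoord (val y j) w -> w 0 l0 != 0].
pose w_ (y : Y) := sval (cid (hcoord_exists (val y j))).
have yw (y : Y) : hcoord (val y j) (w_ y) := svalP (cid (hcoord_exists (val y j))).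
have Ux : U (f x).
  by move=> w xw; have [c c0 ->] := hcoord_scale xv xw; rewrite mxE mulf_neq0.
have h_reg l : regular_on U (fun y => w_ y 0 l / w_ y 0 l0).
  move=> y Uy; exists U; split=> //; [exact: chart_open|].
  exists (fun i => (j == i) : nat), (X_ l), (X_ l0); split; try exact: X_homog.
  move=> z Uz _ M zM; rewrite !mxevalX; split; first exact: Uz (zM j).
  have [c c0 ->] := hcoord_scale (yw z) (zM j).
  by rewrite !mxE -mulf_div divff // mul1r.
have /choice[O OP] l := (f_morph.2 U _ (chart_open l0) (h_reg l)) x Ux.
have /choice[d /choice[q /choice[r qr]]] : forall l, exists d q r,
    [/\ multihomog d q, multihomog d r & forall y, O l y -> (f @^-1` U) y ->
      forall M, mcoord (val y) M -> mxeval M r != 0 /\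
        w_ (f y) 0 l / w_ (f y) 0 l0 = mxeval M q / mxeval M r].
  by move=> l; case: (OP l).
have /choice[dp /choice[p pP]] : forall l, exists d p, [/\ multihomog d p,
    forall M, mcoord (val x) M -> mxeval M p != 0 &
    forall (y : X) M, mcoord (val y) M -> mxeval M p != 0 -> O l y].
  by move=> l; case: (OP l) => oO Ox _; exact: vopen_basic.
have [dU [pU [_ pUx pUP]]] := vopen_basic (f_morph.1 _ (chart_open l0)) Ux.
exists (pU * \prod_l p l), (fun l => q l * \prod_(l' | l' != l) r l').
(* As [q l] and [r l] have the same multidegree [d l], all components get the sum of these
   multidegrees. *)
exists (fun i => \sum_l d l i)%N; split=> [l|M xM|y M yM].
- have qd : multihomog (d l) (q l) by case: (qr l).
  have rd l' : multihomog (d l') (r l') by case: (qr l').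
  have rsd := multihomog_prod (r := index_enum 'I_(ncoords Y)) (P := fun l' => l' !=
    l) rd.
  by move=> mm mmG i; rewrite (multihomogM qd rsd mmG) [RHS](bigD1 l).
- rewrite /mxeval mevalM rmorph_prod /= mulf_neq0 //; first exact: pUx.
  by apply/prodf_neq0 => l _; case: (pP l) => _ px _; exact: px.
rewrite {1}/mxeval mevalM rmorph_prod /= mulf_eq0 negb_or => /andP[pUM /prodf_neq0 pM].
have Uy := pUP y M yM pUM.
have rE l : mxeval M (r l) != 0 /\ w_ (f y) 0 l / w_ (f y) 0 l0 = mxeval M (q l) /
  mxeval M (r l).
  have [_ _ /(_ y)] := qr l; apply=> //.
  by case: (pP l) => _ _ /(_ y M yM); apply; exact: pM.
rewrite (_ : \row_l _ = ((\prod_l mxeval M (r l)) / w_ (f y) 0 l0) *: w_ (f y)).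
  apply: hcoord_scaled; last exact: yw.
  rewrite mulf_neq0 ?invr_eq0 //; last exact: Uy (yw _).
  by apply/prodf_neq0 => l _; case: (rE l).
apply/rowP => l; rewrite !mxE {1}/mxeval mevalM rmorph_prod /=.
have [r0 wE] := rE l.
rewrite [RHS]mulrAC -mulrA wE (bigD1 l (P := predT)) //=.
by rewrite [X in _ = X]mulrC mulrA divfK.
Qed.

Hypothesis X_full : forall z, @vset F X z.
Hypothesis X_pos : (0 < ncoords X)%N.

(** [H] is the primitive tuple proportional to the representation near [x0]. Near another point [x]
    the morphism is given by a tuple [G] proportional to [H], hence equal to [g] times [H]; as [G]
    does not vanish at [x], neither do [g] and [H], so [H] represents the morphism at [x] too. *)
Lemma morphism_representation (x0 : X) :
  exists (H : 'I_(ncoords Y) -> mpoly _ F) e,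
  (forall l, multihomog e (H l)) /\
  forall (x : X) M, mcoord (val x) M ->
    hcoord (val (f x) j) (\row_l mxeval M (H l)).
Proof.
have [p0 [G0 [d0 [G0d p0x G0P]]]] := morphism_local x0.
have [M0 xM0] := mcoord_exists (val x0).
have ev_neq0 M (q : mpoly _ F) : mxeval M q != 0 -> q != 0.
  by apply: contraNneq => ->; rewrite /mxeval meval0.
have [l0 G0l0] : exists l, G0 l != 0.
  have /rV0Pn[l] := hcoord_neq0 (G0P _ _ xM0 (p0x _ xM0)).
  by rewrite mxE => /ev_neq0; exists l.
have [H [G0H Hprim Hl0]] := @mpoly_has_primitives F _ _ G0 l0 G0l0.
have G0E : exists h, forall l, G0 l = h * H l by exact: Hprim.
have [h hE] := G0E.
have h0 : h != 0 by apply: contraNneq G0l0 => h0; rewrite hE h0 mul0r.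
have [|e eP] := multihomog_factor (H := H) (d := d0) h0.
  by move=> l; rewrite -hE.
exists H, e; split=> // x M xM.
have [p [G [d [Gd px GP]]]] := morphism_local x.
(* Both tuples represent [f] where [p * p0] does not vanish, so their minors times [p * p0] vanish
   at all points of the full product [X]. *)
have GG0 : proportional G G0.
  move=> i i'; apply/eqP; rewrite -subr_eq0; apply/eqP.
  have pp0 : p * p0 != 0 by rewrite mulf_neq0 // (ev_neq0 _ _ _ _ (px _ xM), ev_neq0
    _ _ _ _ (p0x _ xM0)).
  apply: (mulfI pp0); rewrite mulr0; apply: mxeval_eq0 => // N N0.
  have [z zN] := mcoord_of N0.
  have zX : z \in (X : set _) by rewrite inE; exact: X_full.
  rewrite /mxeval !mevalM mevalB !mevalM -!/(mxeval N _).
  have [->|pN] := eqVneq (mxeval N p) 0; first by rewrite !mul0r.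
  have [->|p0N] := eqVneq (mxeval N p0) 0; first by rewrite mulr0 mul0r.
  have := hcoord_proportional i i' (GP (SigSub zX) N zN pN) (G0P (SigSub zX) N zN p0N).
  by rewrite !mxE => ->; rewrite subrr mulr0.
have [g gE] := Hprim _ (proportional_trans G0l0 GG0 G0H).
have HM := GP x M xM (px _ xM).
have rowE : \row_l mxeval M (G l) = mxeval M g *: \row_l mxeval M (H l).
  by apply/rowP => l; rewrite !mxE gE /mxeval mevalM.
have g0 : mxeval M g != 0.
  by apply: contraNneq (hcoord_neq0 HM) => g0; rewrite rowE g0 scale0r.
have := hcoord_scaled (invr_neq0 g0) HM.
by rewrite rowE scalerA mulVf // scale1r.
Qed.

End Representation.

(** * Irreducible point varieties *)

Section ClosedSets.
Variable F : closedFieldType.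

Lemma zariski_closed0 k m : zariski_closed (set0 : set (mproj F k m)).
Proof.
exists [set 1] => [_ ->|]; first by exists (fun=> 0%N); exact: multihomog1.
apply/seteqP; split=> // x x1; have [M xM] := mcoord_exists x.
by have /eqP := x1 _ erefl M xM; rewrite /mxeval meval1 oner_eq0.
Qed.

Lemma zariski_closedU k m (Z1 Z2 : set (mproj F k m)) :
  zariski_closed Z1 -> zariski_closed Z2 -> zariski_closed (Z1 `|` Z2).
Proof.
move=> [S1 S1h ->] [S2 S2h ->].
exists [set q | exists q1 q2, [/\ S1 q1, S2 q2 & q = q1 * q2]].
  move=> _ [q1 [q2 [/S1h[d1 q1d] /S2h[d2 q2d] ->]]].
  by eexists; exact: multihomogM q1d q2d.
apply/seteqP; split=> x.
  move=> xZ _ [q1 [q2 [Sq1 Sq2 ->]]] M xM; rewrite /mxeval mevalM -!/(mxeval M _).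
  by case: xZ => xZ; [rewrite (xZ q1) ?mul0r | rewrite (xZ q2) ?mulr0].
move=> x12; have [|] := pselect (zero_locus S1 x); first by left.
move=> /existsNP[q1 /not_implyP[Sq1 /existsNP[M1 /not_implyP[xM1 /eqP q10]]]].
right=> q2 Sq2 M xM; have [d1 q1d] := S1h _ Sq1.
have := x12 (q1 * q2) _ M xM; rewrite /mxeval mevalM -!/(mxeval M _).
move=> /(_ (ex_intro _ q1 (ex_intro _ q2 (And3 Sq1 Sq2 erefl)))) /eqP.
by rewrite mulf_eq0 (negPf (mcoord_eval_neq0 q1d xM1 xM q10)) => /eqP.
Qed.

Lemma vclosedU (X : variety F) (Z1 Z2 : set X) :
  vclosed Z1 -> vclosed Z2 -> vclosed (Z1 `|` Z2).
Proof.
move=> [C1 C1c ->] [C2 C2c ->]; exists (C1 `|` C2) => //.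
exact: zariski_closedU.
Qed.

Lemma virreducible_seq (X : variety F) (T : eqType) (s : seq T) (Z : T -> set X) :
  virreducible X -> (forall t, vclosed (Z t)) ->
  (forall x, exists2 t, t \in s & Z t x) -> exists2 t, t \in s & Z t = setT.
Proof.
move=> [[x0 _] Xirr] Zc.
have closed_seq (s' : seq T) : vclosed [set x | exists2 t, t \in s' & Z t x].
  elim: s' => [|t s' IHs].
    exists set0; first exact: zariski_closed0.
    by apply/seteqP; split=> x // [].
  rewrite (_ : [set _ | _] = Z t `|` [set x | exists2 t, t \in s' & Z t x]).
    exact: vclosedU.
  apply/seteqP; split=> x /=.
    by move=> [t']; rewrite inE => /orP[/eqP ->|]; [left | right; exists t'].
  by case=> [|[t' t's']]; [exists t | exists t'] => //; rewrite inE ?eqxx ?t's' ?orbT.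
elim: s => [|t s IHs] cover; first by have [] := cover x0.
have [|Zt|Zs] := Xirr (Z t) _ (Zc t) (closed_seq s).
- apply/seteqP; split=> // x _; have [t'] := cover x.
  by rewrite inE => /orP[/eqP ->|]; [left | right; exists t'].
- by exists t; rewrite ?mem_head.
have [|t' t's Zt'] := IHs; last by exists t'; rewrite // inE t's orbT.
by move=> x; have : [set x | exists2 t, t \in s & Z t x] x by rewrite Zs.
Qed.

Lemma support_closed (X : variety F)
    (T : {ffun 'I_(nfactors X) -> {set 'I_(ncoords X)}}) :
  vclosed [set x : X | forall M, mcoord (val x) M ->
    forall i j, M i j != 0 -> j \in T i].
Proof.
pose S := [set q : mpoly (nfactors X * ncoords X) F |
  exists i j, j \notin T i /\ q = 'X_(mxvec_index i j)].
exists (zero_locus S).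
  by exists S => // _ [i [j [_ ->]]]; eexists; exact: multihomogX.
apply/seteqP; split=> x /= xT.
  move=> _ [i [j [jT ->]]] M xM; rewrite /mxeval mevalXU mxvecE.
  by apply: contraNeq jT => /(xT M xM).
move=> M xM i j; apply: contraNT => jT.
have := xT 'X_(mxvec_index i j) _ M xM; rewrite /mxeval mevalXU mxvecE => -> //.
by exists i, j.
Qed.

End ClosedSets.

(** * Boxes of words and the language of non-zero words *)

Section Boxes.
Variable m : nat.
Implicit Types (S : nat -> {set 'I_m}) (w : seq 'I_m).

Fixpoint in_box S i w : bool :=
  if w is j :: w' then (j \in S i) && in_box S i.+1 w' else true.

Lemma in_boxP (j0 : 'I_m) S i w :
  reflect (forall l, (l < size w)%N -> nth j0 w l \in S (i + l)%N) (in_box S i w).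
Proof.
elim: w i => [|j w IHw] i /=; first by constructor.
apply: (iffP andP) => [[jS /IHw wS] [|l] //=|wS].
- by rewrite addn0.
- by rewrite ltnS => /wS; rewrite addSnnS.
split; first by have := wS 0%N isT; rewrite addn0.
by apply/IHw => l lw; have := wS l.+1 lw; rewrite addSnnS.
Qed.

Lemma path_coef_neq0 (F : fieldType) (lam : nat -> 'rV[F]_m) i w :
  (path_coef lam i w != 0) = in_box (fun i => [set j | lam i 0 j != 0]%SET) i w.
Proof. by elim: w i => [|j w IHw] i /=;
  rewrite ?oner_neq0 // mulf_eq0 negb_or IHw inE. Qed.

End Boxes.

Section Language.
Variables (F : closedFieldType) (A : monomial_algebra F).
Let m := ngens A.
Implicit Types (u v w : seq 'I_m).

Lemma monomial_catl u v : monomial (A := A) (u ++ v) != 0 -> monomial (A := A) u != 0.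
Proof. by rewrite monomial_cat; apply: contraNneq => ->; rewrite mul0r. Qed.

Lemma monomial_catr u v : monomial (A := A) (u ++ v) != 0 -> monomial (A := A) v != 0.
Proof. by rewrite monomial_cat; apply: contraNneq => ->; rewrite mulr0. Qed.

Hypothesis A_prol : prolongable A.

(** Prolongability allows letters to be appended one at a time; the words [s n] extend each other,
    and [a] is their limit. *)
Lemma infinite_word w : monomial (A := A) w != 0 -> exists a : nat -> 'I_m,
  map a (iota 0 (size w)) = w /\ forall n, monomial (A := A) (map a (iota 0 n)) != 0.
Proof.
move=> w0.
have ex_next u : exists j, monomial (A := A) u != 0 -> monomial (A := A) (rcons u j)
  != 0.
  have [u0|_] := boolP (monomial (A := A) u != 0); last first.
    (* Any letter will do when the monomial of [u] is zero; prolonging [w] shows that there is a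
       letter. *)
    have [v vn _] := A_prol w0; case: v vn => [/(_ erefl)[]|j v _].
    exists j => /notF; case.
  have [[|j v] // _] := A_prol u0.
  by rewrite -monomial_cat -cat_rcons => /monomial_catl; exists j.
have [nx nxP] := choice ex_next.
pose s n := iter n (fun u => rcons u (nx u)) w.
have s0 n : monomial (A := A) (s n) != 0 by elim: n => [|n IHn];
  [exact: w0 | exact: nxP].
have size_s n : size (s n) = (size w + n)%N.
  by elim: n => [|n IHn] /=; rewrite ?addn0 // size_rcons IHn addnS.
pose a i := nth (nx w) (s i.+1) i.
have nth_s n k i : (i < size (s n))%N -> nth (nx w) (s (n + k)%N) i = nth (nx w) (s
  n) i.
  move=> lt_i; elim: k => [|k IHk]; first by rewrite addn0.
  rewrite addnS /= nth_rcons -/(s _) IHk size_s addnA -size_s.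
  by rewrite (leq_trans lt_i) // leq_addr.
have aE n i : (i < size w + n)%N -> a i = nth (nx w) (s n) i.
  move=> lt_i; rewrite /a; case: (leqP n i) => [le_n|lt_n].
    by rewrite -(subnKC (leqW le_n)) nth_s // size_s.
  by rewrite -[in RHS](subnKC lt_n) nth_s // size_s ltn_addl.
have mapE n : map a (iota 0 (size w + n)) = s n.
  apply: (@eq_from_nth _ (nx w)) => [|i]; rewrite size_map size_iota ?size_s // => lt_i.
  by rewrite (nth_map 0%N) ?size_iota // nth_iota // add0n (aE n).
exists a; split=> [|n]; first by rewrite -[size w]addn0 mapE.
have := s0 n; rewrite -mapE addnC iotaD map_cat; exact: monomial_catl.
Qed.

(** In degree [i] of the module only the letter [a i] acts non-trivially. A word that acts
    non-trivially somewhere is thus a factor of the infinite word [a], hence non-zero in [A]. *)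
Lemma word_point w : monomial (A := A) w != 0 ->
  exists2 p, point_seqs A p &
  exists a, map a (iota 0 (size w)) = w /\ forall i, hcoord (p i) (delta_mx 0 (a i)).
Proof.
move=> /infinite_word[a [aw a0]]; pose lam i : 'rV[F]_m := delta_mx 0 (a i).
have lam0 i : lam i != 0.
  by apply/rV0Pn; exists (a i); rewrite mxE !eqxx oner_neq0.
have /choice[p pP] i := hcoord_of (lam0 i).
exists p; last by exists a.
apply: (path_coef_point (lam := lam)) => // v v0 i.
apply: contra_eq v0; rewrite path_coef_neq0 => v_box.
have := a0 (i + size v)%N; rewrite iotaD map_cat => /monomial_catr.
suff -> : [seq a j | j <- iota (0 + i) (size v)] = v by [].
rewrite add0n; elim: v i v_box => //= j v IHv i /andP[].
rewrite inE mxE eqxx /= => ji /IHv ->.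
by have [->//|nji] := eqVneq j (a i); rewrite (negPf nji) eqxx in ji.
Qed.

(** Finitely many supports occur, and the points whose support lies in a given one form a closed
    set; by irreducibility the support of one point contains all others. Words along it are non-zero
    because of that point, and a non-zero word of length [n.+1] lies in it because it defines a
    point itself. *)
Lemma generic_box n : virreducible (pointn A n) -> exists T : nat -> {set 'I_m},
  (forall i, T i != finset.set0) /\ forall w, size w = n.+1 ->
    (monomial (A := A) w != 0) = in_box T 0 w.
Proof.
move=> An_irr.
pose supp (M : 'M[F]_(n.+1, m)) : {ffun 'I_n.+1 -> {set 'I_m}} :=
  [ffun i => [set j | M i j != 0]%SET].
pose s := [seq T <- enum {ffun 'I_n.+1 -> {set 'I_m}} |
  `[< exists (x : pointn A n) M, mcoord (val x) M /\ supp M = T >]].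
have [x|T] := @virreducible_seq F (pointn A n) _ s _ An_irr (@support_closed F
  (pointn A n)).
  have [M xM] := mcoord_exists (val x); exists (supp M).
    by rewrite mem_filter mem_enum inE andbT; apply/asboolP; exists x, M.
  move=> M' xM' i j M'ij; rewrite ffunE inE.
  have [c [_ M'E]] := mcoord_row_scale xM xM'.
  by apply: contraNneq M'ij => Mij; rewrite M'E mxE Mij mulr0.
rewrite mem_filter => /andP[/asboolP[x [M [xM <-]]] _] Tfull.
have [p Ap px] := set_valP x.
have /choice[lam plam] i := hcoord_exists (p i).
exists (fun i => [set j | lam i 0 j != 0]%SET); split=> [i|w wn].
  have /rV0Pn[j lij] := hcoord_neq0 (plam i).
  by apply/finset.set0Pn; exists j; rewrite inE.
rewrite -path_coef_neq0; apply/idP/idP => [w0|]; last first.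
  by apply: contraNneq => w0; have -> := point_seqs_path_coef Ap plam w0 0%N.
have [q Aq [a [aw qa]]] := word_point w0.
have yA : truncate n q \in (pointn A n : set _) by rewrite inE; exists q.
pose N : 'M[F]_(n.+1, m) := \matrix_i (delta_mx 0 (a i)).
have yN : mcoord (truncate n q) N by move=> i; rewrite ffunE rowK.
have Ty (y : pointn A n) M' : mcoord (val y) M' ->
    forall i j, M' i j != 0 -> j \in supp M i.
  by have : setT y by []; rewrite -Tfull => yT; exact: yT.
rewrite path_coef_neq0; apply/(in_boxP (a 0%N)) => l; rewrite wn => lt_l.
rewrite -aw (nth_map 0%N) ?size_iota ?wn // nth_iota // !add0n inE.
pose l' := Ordinal lt_l.
have := Ty (SigSub yA) N yN l' (a l); rewrite !mxE !eqxx oner_neq0 => /(_ isT).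
rewrite ffunE inE => Ml; have := xM l'; rewrite -px ffunE /= => plM.
have [c c0 lamE] := hcoord_scale plM (plam l).
by rewrite lamE !mxE mulf_neq0.
Qed.

(** For every [n] at least [i], the set [T n i] consists of the letters at position [i] of non-zero
    words, so the boxes of different lengths fit together. They decrease because a non-zero word
    stays non-zero without its first letter. *)
Theorem language_box : (forall n, virreducible (pointn A n)) ->
  exists S : nat -> {set 'I_m},
  [/\ forall i, S i != finset.set0, forall i, S i.+1 \subset S i &
      forall w, (monomial (A := A) w != 0) = in_box S 0 w].
Proof.
move=> A_irr; have /choice[T TP] n := generic_box (A_irr n).
pose letter i j := exists w, [/\ (i < size w)%N, monomial (A := A) w != 0 & nth j w i
  = j].
have TE n i j : (i <= n)%N -> j \in T n i <-> letter i j.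
  have [T0 Tbox] := TP n; move=> le_in.
  have /choice[c cT] : forall k, exists j, j \in T n k.
    by move=> k; apply/finset.set0Pn; exact: T0.
  split=> [jT|[w [lt_i w0 wj]]].
    pose c' k := if k == i then j else c k.
    exists (map c' (iota 0 n.+1)); rewrite size_map size_iota ltnS le_in; split=> //.
      rewrite Tbox ?size_map ?size_iota //; apply/(in_boxP j) => l.
      rewrite size_map size_iota => lt_l;
        rewrite (nth_map 0%N) ?size_iota // nth_iota // add0n.
      by rewrite /c'; case: eqP => [->|_].
    by rewrite (nth_map 0%N) ?size_iota ?ltnS // nth_iota ?ltnS // add0n /c' eqxx.
  have [a [aw a0]] := infinite_word w0.
  have := a0 n.+1; rewrite Tbox ?size_map ?size_iota // => /(in_boxP j) /(_ i).
  rewrite size_map size_iota ltnS le_in => /(_ isT).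
  rewrite (nth_map 0%N) ?size_iota ?ltnS // nth_iota ?ltnS // add0n.
  suff -> : a i = j by [].
  by rewrite -[RHS]wj -aw (nth_map 0%N) ?size_iota // nth_iota // add0n.
exists (fun i => T i i); split=> [i|i|w].
- by have [] := TP i.
- apply/fintype.subsetP => j /(TE i.+1 i.+1 j (leqnn _)) lt_j.
  apply/(TE i i j (leqnn _)); case: lt_j => -[|j' w] [lt_i w0 wj]; first by [].
  exists w; split=> //.
  by apply: (@monomial_catr [:: j']).
case: w => [|j w]; first by rewrite monomial_nil oner_neq0.
have [_ Tbox] := TP (size w); rewrite (Tbox (j :: w)) //.
apply/(in_boxP j)/(in_boxP j) => wT l lt_l; have /= le_l := lt_l; rewrite ltnS in le_l.
  by apply/TE => //; apply/(TE (size w)) => //; exact: wT.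
by apply/(TE (size w)) => //; apply/(TE l) => //; exact: wT.
Qed.

End Language.

(** * Killing letters *)

Section KillLetters.
Import finmap monalg.
Variables (F : fieldType) (A : monomial_algebra F) (T : {set 'I_(ngens A)}).
Variables (j0 : 'I_(ngens A)) (Tj0 : j0 \in T).
Let m := ngens A.
Let d := #|T|.
Hypothesis T_words : forall w, all (mem T) w -> monomial (A := A) w != 0.

Let rank : 'I_m -> 'I_d := enum_rank_in Tj0.

Lemma word_cat n (u v : seq 'I_n) : word F (u ++ v) = word F u * word F v.
Proof.
apply/esym; apply: (etrans (fgmulUU _ _ _ _)).
by rewrite /word mulr1; congr (mkmalgU _ _); exact: fmmulE.
Qed.

Lemma word_neq0 n (w : seq 'I_n) : word F w != 0.
Proof. by rewrite -[word F w]/(<< 1 *g FMonom w >>) monalgU_eq0 oner_neq0. Qed.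

Lemma malg_decomp (K : choiceType) (R : nzRingType) (g : {malg R[K]}) :
  g = \sum_(k <- msupp g) mcoeff k g *: << k >>.
Proof.
rewrite [LHS]monalgE; apply: eq_bigr => k _; apply/malgP => k'.
by rewrite mcoeffZ !mcoeffU mulr_natr.
Qed.

Lemma word_decomp n (f : free_alg F n) :
  f = \sum_(w <- msupp f) mcoeff w f *: word F w.
Proof.
apply: (etrans (malg_decomp f)).
by apply: eq_bigr => -[w] _.
Qed.

Definition kill_word (w : {fmonom 'I_m}) : {malg F[{fmonom 'I_d}]} :=
  if all (mem T) w then << FMonom (map rank w) >> else 0.

Lemma kill_word_mmorphism : mmorphism kill_word.
Proof.
split=> [u v|]; last by rewrite /kill_word fm1 /=; congr (mkmalgU _ _); rewrite -fmoneE.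
rewrite /kill_word fmM all_cat map_cat; case: (all _ u); last by rewrite mul0r.
case: (all _ v); last by rewrite mulr0.
exact: (@word_cat d).
Qed.

HB.instance Definition _ :=
  isMultiplicative.Build {fmonom 'I_m} {malg F[{fmonom 'I_d}]} kill_word
    kill_word_mmorphism.

Definition kill (f : {malg F[{fmonom 'I_m}]}) : {malg F[{fmonom 'I_d}]} :=
  mmap (@mkmalgU {fmonom 'I_d} F mone) kill_word f.

Lemma killE f : kill f = \sum_(w <- msupp f) mcoeff w f *: kill_word w.
Proof.
by rewrite /kill mmapE; apply: eq_bigr => w _; rewrite mul_malgC.
Qed.

Lemma killB : zmod_morphism kill.
Proof. exact: mmap_is_additive. Qed.

HB.instance Definition _ := GRing.isZmodMorphism.Build _ _ kill killB.

Lemma killM : monoid_morphism kill.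
Proof.
have comm : forall (g : {malg F[{fmonom 'I_m}]}) m1 m2,
    GRing.comm (@mkmalgU {fmonom 'I_d} F mone (mcoeff m1 g)) (kill_word m2).
  move=> g m1 m2; rewrite /GRing.comm mul_malgC.
  rewrite -[X in _ = _ * X]mulr1 mul_malgC.
  exact: etrans (congr1 _ (esym (mulr1 _))) (free_alg_scalerAr _ _ _).
have [kM k1] := commr_mmap_is_multiplicative comm.
by split.
Qed.

HB.instance Definition _ := GRing.isMonoidMorphism.Build _ _ kill killM.

Lemma killZ c f : kill (c *: f) = c *: kill f.
Proof. by rewrite /kill mmapZ mul_malgC. Qed.

Lemma kill_wordE w : kill << FMonom w >> = kill_word (FMonom w).
Proof. by rewrite /kill mmapU mul_malgC scale1r. Qed.

(** The words generating the ideal vanish in [A], so by [T_words] each of them has a letter outside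
    [T] and is killed. *)
Lemma kill_ker f : mon_proj A f = 0 -> kill f = 0.
Proof.
have [S kerS] := mon_proj_ker A; move=> f0.
have [s sS ->] : gen_ideal [set word F w | w in S] f by rewrite -kerS.
rewrite (raddf_sum kill) big_seq big1 // => t /sS[w Sw wE].
apply: (@etrans _ _ (kill t.1.1 * kill t.1.2 * kill t.2)).
  by rewrite -!(rmorphM kill).
rewrite -wE [X in _ * X * _]kill_wordE /kill_word; case: ifP => [Tw|_].
  suff : monomial (A := A) w = 0 by move/eqP; rewrite (negPf (T_words Tw)).
  rewrite /monomial; change ([set f | mon_proj A f = 0] (word F w)).
  rewrite kerS; exists [:: (1, word F w, 1)]; last by rewrite big_seq1 mul1r mulr1.
  by move=> _ /[!inE] /eqP -> /=; exists w.
by rewrite mulr0 mul0r.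
Qed.

Definition quotient_map (a : A) : free_alg F d := kill (mon_lift a).

Lemma quotient_mapE f : quotient_map (mon_proj A f) = kill f.
Proof.
apply/eqP; rewrite -subr_eq0 /quotient_map; apply/eqP.
apply: (etrans (esym (killB _ _))); apply: kill_ker.
by rewrite rmorphB /= mon_liftK subrr.
Qed.

Lemma quotient_map_linear : linear quotient_map.
Proof.
move=> c a b; rewrite -[a]mon_liftK -[b]mon_liftK -linearP !quotient_mapE.
apply: (etrans (raddfD kill _ _)); congr (_ + _); exact: killZ.
Qed.

Lemma quotient_map_mul : monoid_morphism quotient_map.
Proof.
split=> [|a b].
  by rewrite -(rmorph1 (mon_proj A)) quotient_mapE; exact: (rmorph1 kill).
rewrite -[a]mon_liftK -[b]mon_liftK -rmorphM !quotient_mapE.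
exact: (rmorphM kill).
Qed.

HB.instance Definition _ := GRing.isLinear.Build _ _ _ _ quotient_map
  quotient_map_linear.
HB.instance Definition _ := GRing.isMonoidMorphism.Build _ _ quotient_map
  quotient_map_mul.

Definition quotient_morphism : {lrmorphism A -> free_alg F d} := quotient_map.

Lemma quotient_map_surj g : exists a, quotient_map a = g.
Proof.
pose f : {malg F[{fmonom 'I_m}]} := \sum_(w <- msupp g)
  mcoeff w g *: << FMonom (map (@enum_val _ (mem T)) w) >>.
exists (mon_proj A f); rewrite quotient_mapE [RHS]malg_decomp /f (raddf_sum kill).
apply: eq_bigr => -[w] _; apply: etrans (killZ _ _) _; congr (_ *: _).
rewrite kill_wordE /kill_word /= ifT; last first.
  by apply/allP => _ /mapP[i _ ->]; exact: enum_valP.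
by rewrite -map_comp map_id_in // => i _ /=; exact: enum_valK_in.
Qed.

(** Renaming is injective on words over [T] and all other words are killed, so no two terms are
    merged. *)
Lemma kill_coef f w : all (mem T) w ->
  mcoeff (FMonom (map rank w)) (kill f) = mcoeff (FMonom w) f.
Proof.
move=> Tw; rewrite killE raddf_sum /=.
have coefE (v : {fmonom 'I_m}) : mcoeff (FMonom (map rank w)) (mcoeff v f *:
  kill_word v) =
    mcoeff v f *+ (v == FMonom w).
  rewrite mcoeffZ /kill_word; case: ifP => [Tv|nTv]; last first.
    by rewrite mcoeff0 mulr0; case: eqP nTv => [->|//]; rewrite Tw.
  rewrite mcoeffU mulr_natr; congr (_ *+ (nat_of_bool _)).
  apply/eqP/eqP => [[vw]|-> //].
  case: v Tv vw => v /= Tv vw; congr FMonom.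
  have rankK : {in mem T, cancel rank (@enum_val _ (mem T))} by exact: enum_rankK_in.
  have mapK (u : seq 'I_m) : all (mem T) u -> map (@enum_val _ (mem T)) (map rank u)
    = u.
    by move=> /allP Tu; rewrite -map_comp map_id_in // => j /Tu /rankK.
  by rewrite -(mapK v) // vw mapK.
have [fw|fw] := boolP (FMonom w \in msupp f); last first.
  rewrite big_seq big1 => [|v fv]; first by rewrite mcoeff_outdom.
  by rewrite coefE; case: eqP fv => // ->; rewrite (negPf fw).
rewrite (bigD1_seq (FMonom w) fw (fset_uniq _)) /= coefE eqxx big1 ?addr0 // => v nv.
by rewrite coefE (negPf nv).
Qed.

Lemma quotient_map_ker a : quotient_map a = 0 -> exists f, mon_proj A f = a /\
  forall w : {fmonom 'I_m}, w \in msupp f -> (0 < count (predC (mem T)) w)%N.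
Proof.
move=> a0; exists (mon_lift a); split=> [|[w] fw]; first exact: mon_liftK.
rewrite -has_count has_predC; apply: contraTN fw => Tw.
rewrite -mcoeff_eq0 -(kill_coef _ Tw) -[kill _]/(quotient_map a) a0.
by apply/eqP; exact: mcoeff0.
Qed.

(** Each kernel element lifts to a combination of words with a letter outside [T], and the numbers
    of such letters add up under concatenation. *)
Lemma quotient_map_ker_prod (s : seq A) : (forall a, a \in s -> quotient_map a = 0) ->
  exists f, mon_proj A f = \prod_(a <- s) a /\
  forall w : {fmonom 'I_m}, w \in msupp f -> (size s <= count (predC (mem T)) w)%N.
Proof.
elim: s => [|a s IHs] sK.
  by exists 1; rewrite big_nil rmorph1.
have [|f [fE fP]] := IHs; first by move=> b bs; apply: sK; rewrite inE bs orbT.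
have [g [gE gP]] := quotient_map_ker (sK a (mem_head _ _)).
exists (g * f); split=> [|w]; first by rewrite rmorphM /= gE fE big_cons.
move=> /msuppM_le[u [v [/gP gu /fP fv ->]]].
by rewrite fmM count_cat; exact: (leq_add gu fv).
Qed.

Lemma quotient_map_nilpotent N (s : seq A) :
  (forall w, monomial (A := A) w != 0 -> (count (predC (mem T)) w <= N)%N) ->
  size s = N.+1 -> (forall a, a \in s -> quotient_map a = 0) -> \prod_(a <- s) a = 0.
Proof.
move=> AN sN /quotient_map_ker_prod[f [<- fP]].
rewrite (word_decomp f) (raddf_sum (mon_proj A)) big_seq big1 // => w /fP.
rewrite sN ltnNge => wN; apply: (@etrans _ _ (mcoeff w f *: monomial (A := A) w)).
  exact: linearZ.
suff -> : monomial (A := A) w = 0 by rewrite scaler0.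
by apply/eqP; apply: contraT => /AN; rewrite (negPf wN).
Qed.

End KillLetters.

Lemma in_box_all m (S : nat -> {set 'I_m}) N i w : (forall i, (N <= i)%N -> S i = S
  N) ->
  (N <= i)%N -> in_box S i w -> all (mem (S N)) w.
Proof.
move=> SN; elim: w i => //= j w IHw i le_i /andP[]; rewrite SN // => ->.
by apply: IHw; exact: leqW.
Qed.

Lemma in_box_cat m (S : nat -> {set 'I_m}) i u v :
  in_box S i (u ++ v) = in_box S i u && in_box S (i + size u) v.
Proof.
by elim: u i => [|j u IHu] i /=; rewrite ?addn0 // IHu andbA addSnnS.
Qed.

(** From position [N] on, the letters of a non-zero word lie in [S N], so at most [N] letters lie
    outside; hence the exponent [N.+1]. Words over [S N] are non-zero because [S N] is contained in
    every [S i]. *)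
Lemma box_quotient (F : fieldType) (A : monomial_algebra F)
    (S : nat -> {set 'I_(ngens A)}) N :
  (forall i, S i != finset.set0) -> (forall i, S i.+1 \subset S i) ->
  (forall w, (monomial (A := A) w != 0) = in_box S 0 w) ->
  (forall i, (N <= i)%N -> S i = S N) ->
  exists phi : {lrmorphism A -> free_alg F #|S N|},
    (forall g, exists a, phi a = g) /\
    forall s : seq A, size s = N.+1 -> (forall a, a \in s -> phi a = 0) ->
      \prod_(a <- s) a = 0.
Proof.
move=> S0 Sdec Sbox Sstab; have /finset.set0Pn[j0 Sj0] := S0 N.
have Ssub i : S N \subset S i.
  have [/Sstab -> //|/ltnW le_iN] := leqP N i.
  rewrite -(subnK le_iN); elim: (N - i)%N => [|k IHk]; first exact: subxx.
  exact: fintype.subset_trans (Sdec _) IHk.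
have words w : all (mem (S N)) w -> monomial (A := A) w != 0.
  rewrite Sbox; move: 0%N; elim: w => //= j w IHw i /andP[jS /IHw ->].
  by rewrite andbT (fintype.subsetP (Ssub i)).
exists (quotient_morphism Sj0 words); split; first exact: quotient_map_surj.
move=> s; apply: quotient_map_nilpotent => w; rewrite Sbox.
rewrite -{1}(cat_take_drop N w) in_box_cat add0n => /andP[_ w_tail].
rewrite -(cat_take_drop N w) count_cat (eqP (_ : count _ (drop N w) == 0%N)) ?addn0.
  by rewrite (leq_trans (count_size _ _)) // size_take; case: ltnP.
rewrite -leqn0 leqNgt -has_count has_predC negbK.
have [lt_N|le_N] := ltnP N (size w); last by rewrite drop_oversize.
by move: w_tail; rewrite size_takel ?(ltnW lt_N) //; exact: in_box_all.
Qed.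

Lemma decreasing_sets_stable m (S : nat -> {set 'I_m}) :
  (forall i, S i.+1 \subset S i) -> exists N, forall i, (N <= i)%N -> S i = S N.
Proof.
move=> Sdec; pose card_S c := `[< exists i, #|S i| = c >].
have exc : exists c, card_S c by exists #|S 0%N|; apply/asboolP; exists 0%N.
case: (ex_minnP exc) => c /asboolP[N Nc] cmin; exists N => i le_Ni.
apply/eqP; rewrite eqEcard Nc; apply/andP; split.
  rewrite -(subnK le_Ni); elim: (i - N)%N => [|k IHk]; first exact: subxx.
  exact: fintype.subset_trans (Sdec _) IHk.
by apply: cmin; apply/asboolP; exists i.
Qed.

(** * Morphisms of proalgebraic varieties *)

Section Morphisms.
Variable F : closedFieldType.
Implicit Types X Y Z : variety F.

Lemma vmorphism_id X : vmorphism (id : X -> X).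
Proof. by split=> // U h _ h_reg; exact: h_reg. Qed.

Lemma vmorphism_comp X Y Z (g : Y -> Z) (f : X -> Y) :
  vmorphism g -> vmorphism f -> vmorphism (g \o f).
Proof.
move=> [gc gr] [fc fr]; split=> [C /gc /fc //|U h Uo /(gr U h Uo)].
apply: fr; rewrite /vopen preimage_setC; exact: gc.
Qed.

Lemma pa_trans_morphism (X : proalgebraic F) i n (le_in : (i <= n)%N) :
  vmorphism (@pa_trans F X i n le_in).
Proof.
elim: n le_in => [|n IHn] le_in.
  have i0 : i = 0%N by apply/eqP; rewrite -leqn0.
  subst i; rewrite (_ : pa_trans _ = id); first exact: vmorphism_id.
  by apply/funext => x; exact: pa_trans_refl.
have [le_in'|ge_in] := leqP i n.
  rewrite (_ : pa_trans _ = pa_trans le_in' \o @pa_map _ X n).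
    by apply: vmorphism_comp; [exact: IHn | exact: pa_map_morphism].
  by apply/funext => x; exact: pa_transS.
have i_n : i = n.+1 by apply/eqP; rewrite eqn_leq le_in.
subst i; rewrite (_ : pa_trans _ = id); first exact: vmorphism_id.
by apply/funext => x; exact: pa_trans_refl.
Qed.

(** Level [j] of the image is given by a morphism from a single level of the source, and composing
    with transition maps raises that level above any [K0]. *)
Lemma pa_image_factor (X Y : proalgebraic F) (f : pa_morphism X Y) j K0 :
  exists K, (K0 <= K)%N /\ exists phi : pa_var X K -> pa_var Y j,
    vmorphism phi /\ forall a, sval (pa_image f a) j = phi (sval a K).
Proof.
pose n := maxn j (mor_start f); pose sn := leq_maxr j (mor_start f).
exists (maxn K0 (mor_index f n)); split; first exact: leq_maxl.
exists (@pa_trans _ Y _ _ (leq_maxl j (mor_start f)) \o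
  (mor_fun sn \o @pa_trans _ X _ _ (leq_maxr K0 (mor_index f n)))); split.
  apply: vmorphism_comp; first exact: pa_trans_morphism.
  apply: vmorphism_comp; [exact: mor_fun_morphism | exact: pa_trans_morphism].
by move=> a /=; rewrite pa_trans_point.
Qed.

Lemma virreducible_image X Y (f : X -> Y) : vmorphism f ->
  (forall y, exists x, f x = y) -> virreducible X -> virreducible Y.
Proof.
move=> [fc _] f_surj [[x0 _] X_irr]; split; first by exists (f x0).
move=> Z1 Z2 Z1c Z2c Z12.
have [||] := X_irr _ _ (fc _ Z1c) (fc _ Z2c).
- by rewrite -preimage_setU Z12 preimage_setT.
- move=> fZ; left; apply/seteqP; split=> // y _; have [x <-] := f_surj y.
  by have : (f @^-1` Z1) x by rewrite fZ.
- move=> fZ; right; apply/seteqP; split=> // y _; have [x <-] := f_surj y.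
  by have : (f @^-1` Z2) x by rewrite fZ.
Qed.

(** Proper closed sets lie in the zero loci of non-zero polynomials [q1] and [q2]; if two of them
    covered [X], the non-zero product would vanish at all points. *)
Lemma virreducible_full X : (forall z, @vset F X z) -> (0 < ncoords X)%N ->
  [set: X] !=set0 -> virreducible X.
Proof.
move=> X_full X_pos X0;
  split=> // Z1 Z2 [C1 [S1 S1h C1E] Z1E] [C2 [S2 S2h C2E] Z2E] Z12.
have notC S : ~ (forall x : X, zero_locus S (val x)) -> exists q, S q /\ q != 0.
  move=> /existsNP[x /existsNP[q /not_implyP[Sq /existsNP[M]]]].
  move=> /not_implyP[xM /eqP q0]; exists q; split=> //.
  by apply: contraNneq q0 => ->; rewrite /mxeval meval0.
have [C1T|/notC[q1 [Sq1 q10]]] := pselect (forall x : X, zero_locus S1 (val x)).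
  by left; rewrite Z1E C1E; apply/seteqP; split=> // x _; exact: C1T.
have [C2T|/notC[q2 [Sq2 q20]]] := pselect (forall x : X, zero_locus S2 (val x)).
  by right; rewrite Z2E C2E; apply/seteqP; split=> // x _; exact: C2T.
have /eqP := mulf_neq0 q10 q20; case; apply: mxeval_eq0 => // M M0.
have [z zM] := mcoord_of M0.
have zX : z \in (X : set _) by rewrite inE; exact: X_full.
rewrite /mxeval mevalM -!/(mxeval M _).
have : (Z1 `|` Z2) (SigSub zX : X) by rewrite Z12.
rewrite Z1E Z2E C1E C2E => -[] zS.
  by rewrite (zS _ Sq1 _ zM) mul0r.
by rewrite (zS _ Sq2 _ zM) mulr0.
Qed.

End Morphisms.

(** * Maps given by multihomogeneous polynomials *)

Section PolynomialMaps.
Variables (F : closedFieldType) (X Y : variety F) (f : X -> Y).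
Variable P : 'M[mpoly (nfactors X * ncoords X) F]_(nfactors Y, ncoords Y).
Variable D : 'I_(nfactors Y) -> 'I_(nfactors X) -> nat.
Hypothesis P_homog : forall i j, multihomog (D i) (P i j).
Hypothesis P_coord : forall x M, mcoord (val x) M ->
  mcoord (val (f x)) (map_mx (mxeval M) P).

Definition pullback (q : mpoly (nfactors Y * ncoords Y) F) :
    mpoly (nfactors X * ncoords X) F :=
  \sum_(mm <- msupp q) q@_mm *: \prod_i \prod_j P i j ^+ mm (mxvec_index i j).

Lemma pullback_eval q M : mxeval M (pullback q) = mxeval (map_mx (mxeval M) P) q.
Proof.
rewrite /mxeval /pullback raddf_sum mevalE; apply: eq_bigr => mm _ /=.
rewrite mevalZ prod_mxvec_index rmorph_prod; congr (_ * _); apply: eq_bigr => i _ /=.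
rewrite rmorph_prod; apply: eq_bigr => j _ /=.
by rewrite rmorphXn mxvecE mxE.
Qed.

Lemma multihomogXn k m d (q : mpoly (k * m) F) n : multihomog d q ->
  multihomog (fun i => d i * n)%N (q ^+ n).
Proof.
move=> qd; elim: n => [|n IHn].
  by move=> mm; rewrite expr0 => mm1 i; rewrite muln0; exact: multihomog1 mm1 i.
by move=> mm; rewrite exprS => mmq i; rewrite (multihomogM qd IHn mmq) mulnS.
Qed.

Lemma pullback_homog d q : multihomog d q ->
  multihomog (fun i' => \sum_i D i i' * d i)%N (pullback q).
Proof.
move=> qd mm' /msupp_sum_le /flatten_mapP[mm]; rewrite filter_predT => qmm.
move=> /msuppZ_le mm'P i'.
have PD i := multihomog_prod (r := index_enum 'I_(ncoords Y)) (P := predT)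
  (fun j => multihomogXn (n := mm (mxvec_index i j)) (@P_homog i j)).
rewrite (multihomog_prod (r := index_enum 'I_(nfactors Y)) (P := predT) PD mm'P).
by apply: eq_bigr => i _; rewrite -big_distrr /= (qd _ qmm).
Qed.

Lemma poly_map_morphism : vmorphism f.
Proof.
have closed_pre (Z : set Y) : vclosed Z -> vclosed (f @^-1` Z).
  case=> C [S Sh CE] ZE; exists (zero_locus (pullback @` S)).
    exists (pullback @` S) => // _ [q Sq <-]; have [d qd] := Sh q Sq.
    by eexists; exact: pullback_homog qd.
  rewrite ZE CE; apply/seteqP; split=> x /= x0.
    by move=> _ [q Sq <-] M xM; rewrite pullback_eval; exact: (x0 q Sq _ (P_coord xM)).
  move=> q Sq N yN; have [M xM] := mcoord_exists (val x).
  have q0 : mxeval (map_mx (mxeval M) P) q = 0.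
    by rewrite -pullback_eval; apply: x0 => //; exists q.
  have [d qd] := Sh q Sq; apply/eqP; apply: contraT => qN.
  by have := mcoord_eval_neq0 qd yN (P_coord xM) qN; rewrite q0 eqxx.
split=> // U h Uo hreg x Ufx; have [O [Oo Ofx [d [q [r [qd rd hE]]]]]] := hreg _ Ufx.
exists (f @^-1` O); split=> //; first by rewrite /vopen preimage_setC;
  exact: closed_pre.
eexists; exists (pullback q), (pullback r).
split=> [||y Oy Uy M yM]; [exact: pullback_homog qd | exact: pullback_homog rd |].
by rewrite !pullback_eval; apply: hE => //; exact: P_coord.
Qed.

End PolynomialMaps.

(** * Forms of degree one *)

Lemma prod_expr_sum1 (R : comNzRingType) n (v : 'I_n -> R) (e : 'I_n -> nat) :
  (\sum_j e j = 1)%N -> \prod_j v j ^+ e j = \sum_j v j *+ e j.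
Proof.
move=> e1; have [j ej] : exists j, e j != 0%N.
  apply: contrapT => /forallNP e0; suff : (\sum_j e j = 0)%N by rewrite e1.
  by apply: big1 => j _; apply/eqP; apply: contrapT => ej; apply: (e0 j); apply/negP.
have [ej1 e0] : e j = 1%N /\ forall j', j' != j -> e j' = 0%N.
  move: e1; rewrite (bigD1 j) //=; case: (e j) ej => // -[|n'] _; last by case.
  by rewrite add1n => -[/eqP]; rewrite sum_nat_eq0 => /forall_inP e0;
    split=> // j' /e0 /eqP.
rewrite (bigD1 j) //= [RHS](bigD1 j) //= ej1 expr1 mulr1n.
by rewrite !big1 ?mulr1 ?addr0 // => j' /e0 ->.
Qed.

Section LinearRows.
Variables (F : closedFieldType) (k m : nat).

Definition set_row (M : 'M[F]_(k, m)) i (v : 'rV[F]_m) : 'M[F]_(k, m) :=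
  \matrix_i' if i' == i then v else row i' M.

(** Each monomial contains exactly one variable of row [i], with exponent one; its other variables
    are evaluated at the fixed rows of [M]. *)
Lemma mxeval_set_row (q : mpoly (k * m) F) d i M : multihomog d q -> d i = 1%N ->
  exists c : 'I_m -> F, forall v, mxeval (set_row M i v) q = \sum_j v 0 j * c j.
Proof.
move=> qd di; pose C mm := \prod_(i' | i' != i) \prod_j M i' j ^+ mm (mxvec_index i' j).
exists (fun j => \sum_(mm <- msupp q) q@_mm * C mm *+ mm (mxvec_index i j)) => v.
under [RHS]eq_bigr => j _ do rewrite mulr_sumr.
rewrite exchange_big /mxeval mevalE big_seq [RHS]big_seq; apply: eq_bigr => mm qmm.
rewrite prod_mxvec_index (bigD1 i) //=.
under eq_bigr => j _ do rewrite mxvecE mxE eqxx.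
rewrite prod_expr_sum1; last by rewrite (qd _ qmm) di.
have -> : \prod_(i' | i' != i) \prod_j
    mxvec (set_row M i v) 0 (mxvec_index i' j) ^+ mm (mxvec_index i' j) = C mm.
  apply: eq_bigr => i' /negPf ni; apply: eq_bigr => j _.
  by rewrite mxvecE mxE ni mxE.
rewrite mulr_suml mulr_sumr; apply: eq_bigr => j _.
by rewrite mulrnAl !mulrnAr mulrCA.
Qed.

Lemma row_mx_linear n (H : 'I_n -> mpoly (k * m) F) d i M :
  (forall l, multihomog d (H l)) -> d i = 1%N ->
  exists B : 'M[F]_(m, n), forall v, \row_l mxeval (set_row M i v) (H l) = v *m B.
Proof.
move=> Hd di; have /choice[c cP] l := mxeval_set_row M (@Hd l) di.
exists (\matrix_(j, l) c l j) => v; apply/rowP => l; rewrite !mxE cP.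
by apply: eq_bigr => j _; rewrite mxE.
Qed.

End LinearRows.

Lemma injective_mx_leq (F : fieldType) n p (B : 'M[F]_(n, p)) :
  (forall v : 'rV_n, v != 0 -> v *m B != 0) -> (n <= p)%N.
Proof.
move=> Binj; have /eqP <- : row_free B.
  by apply: inj_row_free => v /eqP; apply: contraTeq => /Binj.
exact: rank_leq_col.
Qed.

Lemma line_eval (F : fieldType) n (q : {mpoly F[n]}) (P : 'I_n -> {poly F}) :
  exists p : {poly F}, forall t, p.[t] = q.@[fun u => (P u).[t]].
Proof.
exists (\sum_(mm <- msupp q) q@_mm *: \prod_u P u ^+ mm u) => t.
rewrite mevalE horner_sum; apply: eq_bigr => mm _.
by rewrite hornerZ horner_prod; congr (_ * _); apply: eq_bigr => u _;
  rewrite horner_exp.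
Qed.

(* On the line through [e0] and [e1], dehomogenizing at either point turns
   [h0] and [h1] into polynomials without zeros, hence into constants. *)
Lemma identity_degree1 (F : closedFieldType) a (r0 r1 : 'I_a) D
    (h0 h1 c : 'rV[F]_a -> F) : r0 != r1 ->
  (forall v, v != 0 -> [/\ c v != 0, h0 v = c v * v 0 r0 & h1 v = c v * v 0 r1]) ->
  (forall s v, h0 (s *: v) = s ^+ D * h0 v) ->
  (forall u v, exists p : {poly F}, forall t, p.[t] = h0 (u + t *: v)) ->
  (forall u v, exists p : {poly F}, forall t, p.[t] = h1 (u + t *: v)) ->
  D = 1%N.
Proof.
move=> r01 hc h0D h0poly h1poly.
pose e0 : 'rV[F]_a := delta_mx 0 r0; pose e1 : 'rV[F]_a := delta_mx 0 r1.
have e0E t : (e0 + t *: e1) 0 r0 = 1.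
  by rewrite !mxE !eqxx (negPf r01) mulr0 addr0.
have e1E t : (e1 + t *: e0) 0 r1 = 1.
  by rewrite !mxE !eqxx eq_sym (negPf r01) mulr0 addr0.
have neq0 (v : 'rV[F]_a) r : v 0 r = 1 -> v != 0.
  by move=> v1; apply/rV0Pn; exists r; rewrite v1 oner_neq0.
have const (p : {poly F}) : (forall t, p.[t] != 0) -> exists2 b, b != 0 & forall t,
  p.[t] = b.
  move=> p0; have : size p == 1%N.
    by apply: contraT => /closed_rootP[t]; rewrite rootE (negPf (p0 t)).
  by move=> /size_poly1P[b b0 ->]; exists b => // t; rewrite hornerC.
have [A AE] := h0poly e0 e1; have [B BE] := h1poly e1 e0.
have [|al al0 Aal] := const A.
  by move=> t; rewrite AE; have [ct -> _] := hc _ (neq0 _ _ (e0E t)); rewrite e0E mulr1.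
have [|be be0 Bbe] := const B.
  by move=> t; rewrite BE; have [ct _ ->] := hc _ (neq0 _ _ (e1E t)); rewrite e1E mulr1.
(* The vectors [e0 + s^-1 *: e1] and [e1 + s *: e0] differ by the factor [s]. *)
have key s : s != 0 -> s ^+ D * al = s * be.
  move=> s0; rewrite -(Aal s^-1) AE -h0D scalerDr scalerA divff // scale1r addrC.
  have [_ -> h1E] := hc _ (neq0 _ _ (e1E s)).
  rewrite -(Bbe s) BE h1E e1E mulr1 mulrC; congr (_ * _).
  by rewrite !mxE !eqxx (negPf r01) add0r mulr1.
have albe : al = be by have := key 1 (oner_neq0 _); rewrite expr1n !mul1r.
(* The additional factor ['X] makes the difference vanish at zero for every [D]. *)
have : 'X^(D.+1) - 'X^2 = 0 :> {poly F}.
  apply: contraTeq isT => /poly_neq0_eval[s]; rewrite !hornerE.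
  have [->|s0] := eqVneq s 0; first by rewrite !expr0n /= subrr eqxx.
  have sD : s ^+ D = s by apply: (mulIf al0); rewrite key // albe.
  by rewrite exprS sD subrr eqxx.
by move=> /subr0_eq /(congr1 (fun p : {poly F} => size p)); rewrite !size_polyXn => -[].
Qed.

(** * Points of a box *)

Section PointVarietyPoints.
Variables (F : closedFieldType) (A : monomial_algebra F).
Let m := ngens A.

Lemma point_seqs_pa_point p : point_seqs A p ->
  exists a : pa_point (point_variety A), forall n, val (sval a n) = truncate n p.
Proof.
move=> Ap.
have pA n : truncate n p \in (pointn A n : set _) by rewrite inE; exists p.
pose a n : pa_var (point_variety A) n := SigSub (pA n).
have aP n : pa_map (a n.+1) = a n.
  by apply: val_inj; rewrite /= drop_last_truncate.
by exists (exist (fun a : forall n, pa_var (point_variety A) n =>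
  forall n, pa_map (a n.+1) = a n) a aP).
Qed.

Lemma pa_point_lift n (x : pa_var (point_variety A) n) :
  exists a : pa_point (point_variety A), sval a n = x.
Proof.
have [p Ap px] := set_valP x; have [a aP] := point_seqs_pa_point Ap.
by exists a; apply: val_inj; rewrite aP.
Qed.

Definition pa_coord (a : pa_point (point_variety A)) (i : nat) : proj_space F m :=
  val (sval a i) ord_max.

Lemma pa_coordE (a : pa_point (point_variety A)) n (i : 'I_n.+1) :
  val (sval a n) i = pa_coord a i.
Proof.
elim: n i => [|n IHn] i; have [i' ->|->] := unliftP ord_max i => //; first by case: i'.
have -> : lift ord_max i' = widen_ord (leqnSn n.+1) i'.
  by apply: val_inj; rewrite /= /bump leqNgt ltn_ord.
by rewrite [RHS]/= -IHn -(svalP a n) [in RHS]/= ffunE.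
Qed.

Lemma pa_point_eq (a b : pa_point (point_variety A)) :
  pa_coord a =1 pa_coord b -> a = b.
Proof.
move=> ab; have sE : sval a = sval b.
  apply: functional_extensionality_dep => n; apply: val_inj; apply/ffunP => i.
  by rewrite !pa_coordE ab.
case: a b sE {ab} => [a aP] [b bP] /= sE; subst b; congr exist.
exact: Prop_irrelevance.
Qed.

Variable S : nat -> {set 'I_m}.
Hypothesis S0 : forall i, S i != finset.set0.
Hypothesis Sdec : forall i, S i.+1 \subset S i.
Hypothesis Sbox : forall w, (monomial (A := A) w != 0) = in_box S 0 w.

(** A non-zero coordinate extends to a word along the point, which is then non-zero in [A].
    Conversely, a word acting non-trivially in degree [i] has its letters in [S i], [S i.+1] and so
    on, hence in [S 0], [S 1] and so on, as the sets decrease. *)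
Lemma point_seqs_box p : point_seqs A p <->
  forall i v j, hcoord (p i) v -> v 0 j != 0 -> j \in S i.
Proof.
have /choice[lam plam] i := hcoord_exists (p i).
split=> [Ap i v j pv vj|pS].
  have /choice[c cP] k : exists j, lam k 0 j != 0.
    by have /rV0Pn := hcoord_neq0 (plam k).
  have li : lam i 0 j != 0.
    by have [b b0 lE] := hcoord_scale pv (plam i); rewrite lE mxE mulf_neq0.
  pose c' k := if k == i then j else c k.
  have : path_coef lam 0 (map c' (iota 0 i.+1)) != 0.
    rewrite path_coef_neq0; apply/(in_boxP j) => l; rewrite size_map size_iota => lt_l.
    rewrite (nth_map 0%N) ?size_iota // nth_iota // add0n inE /c'.
    by have [->|_] := eqVneq l i; [exact: li | exact: cP].
  move=> w0; have : monomial (A := A) (map c' (iota 0 i.+1)) != 0.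
    by apply: contraNneq w0 => w0; rewrite (point_seqs_path_coef Ap plam w0 0%N).
  rewrite Sbox => /(in_boxP j) /(_ i).
  rewrite size_map size_iota => /(_ (leqnn _)).
  by rewrite (nth_map 0%N) ?size_iota // nth_iota // add0n /c' eqxx.
apply: (path_coef_point (lam := lam)) => // [i|w w0 i].
  exact: hcoord_neq0 (plam i).
apply: contra_eq w0 => lamw; rewrite Sbox; case: w lamw => // j0 w lamw.
apply/(in_boxP j0) => l lt_l; rewrite add0n.
move: lamw; rewrite path_coef_neq0 => /(in_boxP j0) /(_ l lt_l).
rewrite inE => /(pS _ _ _ (plam _)).
elim: i => [//|i IHi]; rewrite addSn => /(fintype.subsetP (Sdec _)); exact: IHi.
Qed.

Lemma pa_coord_box (a : pa_point (point_variety A)) i v j :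
  hcoord (pa_coord a i) v -> v 0 j != 0 -> j \in S i.
Proof.
rewrite /pa_coord; have [p Ap <-] := set_valP (sval a i); rewrite ffunE.
by move/point_seqs_box: Ap; apply.
Qed.

End PointVarietyPoints.

Lemma free_point_seqs (F : closedFieldType) d (p : nat -> proj_space F d) :
  point_seqs (free_monomial_algebra F d) p.
Proof.
have /choice[lam plam] i := hcoord_exists (p i).
apply: (@path_coef_point F (free_monomial_algebra F d) lam) => // [i|w].
  exact: hcoord_neq0 (plam i).
by move=> w0; have /eqP := word_neq0 F w.
Qed.

Lemma free_pointn_full (F : closedFieldType) d n (z : mproj F n.+1 d) :
  @vset F (pointn (free_monomial_algebra F d) n) z.
Proof.
exists (fun i => z (inord i)); first exact: free_point_seqs.
by apply/ffunP => i; rewrite ffunE inord_val.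
Qed.

Section CoordinateLine.
Variables (F : closedFieldType) (A : monomial_algebra F).
Let m := ngens A.
Variable S : nat -> {set 'I_m}.
Hypothesis S0 : forall i, S i != finset.set0.
Hypothesis Sdec : forall i, S i.+1 \subset S i.
Hypothesis Sbox : forall w, (monomial (A := A) w != 0) = in_box S 0 w.

Fact full_closed k n : zariski_closed [set: mproj F k n].
Proof.
exists set0 => //; apply/seteqP; split=> // x _ q [].
Qed.

Definition full_variety k n : variety F := Variety (full_closed k n).

Definition coord_incl (T : {set 'I_m}) : 'M[F]_(#|T|, m) :=
  \matrix_r delta_mx 0 (enum_val r).

Lemma coord_inclE (T : {set 'I_m}) (v : 'rV[F]_#|T|) r :
  (v *m coord_incl T) 0 (enum_val r) = v 0 r.
Proof.
rewrite mxE (bigD1 r) //= big1 ?addr0 => [|r' nr].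
  by rewrite !mxE !eqxx mulr1.
by rewrite !mxE (inj_eq enum_val_inj) eq_sym (negPf nr) mulr0.
Qed.

Lemma coord_incl_supp (T : {set 'I_m}) (v : 'rV[F]_#|T|) j :
  (v *m coord_incl T) 0 j != 0 -> j \in T.
Proof.
apply: contraNT => jT; rewrite mxE big1 // => r _; rewrite !mxE eqxx /=.
by case: eqP jT => [->|]; rewrite ?enum_valP // mulr0.
Qed.

Lemma coord_incl_neq0 (T : {set 'I_m}) (v : 'rV[F]_#|T|) :
  v != 0 -> v *m coord_incl T != 0.
Proof.
move=> /rV0Pn[r vr]; apply/rV0Pn; exists (enum_val r).
by rewrite coord_inclE.
Qed.

(** All factors but the [i]-th stay at a coordinate point of the box, and the [i]-th runs linearly
    through the coordinate subspace of [S i]. *)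
Lemma factor_embedding i n : (i <= n)%N ->
  exists iota : full_variety 1 #|S i| -> pointn A n,
    vmorphism iota /\
    forall (x : full_variety 1 #|S i|) v, hcoord (val x ord0) v ->
      hcoord (val (iota x) (inord i)) (v *m coord_incl (S i)).
Proof.
move=> le_in.
have /choice[lin linP] : forall L : proj_space F #|S i|, exists L' : proj_space F m,
    forall v, hcoord L v -> hcoord L' (v *m coord_incl (S i)).
  move=> L; have [v0 Lv0] := hcoord_exists L.
  have [L' L'v0] := hcoord_of (coord_incl_neq0 (hcoord_neq0 Lv0)).
  exists L' => v Lv; have [c c0 ->] := hcoord_scale Lv0 Lv.
  by rewrite -scalemxAl; exact: hcoord_scaled.
have /choice[s sS] : forall k, exists j, j \in S k.
  by move=> k; apply/finset.set0Pn.
have delta0 k : (delta_mx 0 (s k) : 'rV[F]_m) != 0.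
  by apply/rV0Pn; exists (s k); rewrite mxE !eqxx oner_neq0.
have /choice[cp cpP] k := hcoord_of (delta0 k).
pose p (x : full_variety 1 #|S i|) k := if k == i then lin (val x ord0) else cp k.
have Ap x : point_seqs A (p x).
  apply/(point_seqs_box Sdec Sbox) => k v j; rewrite /p.
  have [->|nki] := eqVneq k i => pv vj.
    have [w xw] := hcoord_exists (val x ord0).
    have [c _ vE] := hcoord_scale (linP _ _ xw) pv.
    apply: (coord_incl_supp (v := w)).
    have vjE : v 0 j = c * (w *m coord_incl (S i)) 0 j by rewrite vE [LHS]mxE.
    by apply: contraNneq vj => e; rewrite vjE e mulr0.
  have [c _ vE] := hcoord_scale (cpP k) pv.
  have [->|/negPf nj] := eqVneq j (s k); first exact: sS.
  by move: vj; rewrite vE !mxE nj andbF mulr0 eqxx.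
have pA x : truncate n (p x) \in (pointn A n : set _) by rewrite inE; exists (p x).
pose iota (x : full_variety 1 #|S i|) : pointn A n := SigSub (pA x).
exists iota; split; last first.
  by move=> x v xv; rewrite ffunE inordK ?ltnS // /p eqxx; exact: linP.
pose P : 'M[mpoly (1 * #|S i|) F]_(n.+1, m) := \matrix_(i', j)
  if i' == inord i then \sum_r coord_incl (S i) r j *: 'X_(mxvec_index ord0 r)
  else (delta_mx 0 (s i') : 'rV[F]_m) 0 j *: 1.
pose D (i' : 'I_n.+1) (_ : 'I_1) := (i' == inord i) : nat.
apply: (@poly_map_morphism F (full_variety 1 #|S i|) (pointn A n) iota P D).
  move=> i' j mm; rewrite mxE /D; case: eqP => _.
    move=> /msupp_sum_le /flatten_mapP[r _ /msuppZ_le].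
    rewrite msuppX inE => /eqP -> k; rewrite [k]ord1 (bigD1 r) //= mnm1E eqxx.
    rewrite big1 // => r' nr; rewrite mnm1E; case: eqP => // /mxvec_index_inj[_ rr].
    by rewrite rr eqxx in nr.
  by move=> /msuppZ_le /(@multihomog1 F).
move=> x M xM i'; rewrite ffunE /p -[i' == i :> nat]/(i' == i :> nat).
have i'E : (i' == i :> nat) = (i' == inord i).
  by rewrite -val_eqE /= inordK.
rewrite i'E; case: ifP => ii'.
  suff -> : row i' (map_mx (mxeval M) P) = row ord0 M *m coord_incl (S i).
    by apply: linP; exact: xM.
  apply/rowP => j; rewrite !mxE ii' /mxeval raddf_sum /=; apply: eq_bigr => r _.
  by rewrite mevalZ mevalXU mxvecE !mxE mulrC.
suff -> : row i' (map_mx (mxeval M) P) = delta_mx 0 (s i') by exact: cpP.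
by apply/rowP => j; rewrite !mxE ii' /mxeval mevalZ meval1 mulr1.
Qed.

End CoordinateLine.

(** * Isomorphisms with the point variety of a free algebra *)

Section FactorDimensions.
Variables (F : closedFieldType) (A : monomial_algebra F) (d : nat).
Let m := ngens A.
Variable S : nat -> {set 'I_m}.
Hypothesis S0 : forall i, S i != finset.set0.
Hypothesis Sdec : forall i, S i.+1 \subset S i.
Hypothesis Sbox : forall w, (monomial (A := A) w != 0) = in_box S 0 w.
Let X := point_variety A.
Let Y := point_variety (free_monomial_algebra F d).
Variables (f : pa_morphism X Y) (g : pa_morphism Y X).
Hypothesis fK : cancel (pa_image f) (pa_image g).
Hypothesis d_pos : (0 < d)%N.

(** On the [i]-th factor of [X], the [i]-th component of [g] after [f] is the identity. Comparing
    degrees yields a factor [j] of [Y] through which both maps are linear; neither sends a non-zero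
    vector to zero, which bounds the cardinality from both sides. *)
Lemma factor_card i : (1 < #|S i|)%N -> #|S i| = d.
Proof.
move=> a1; set a := #|S i|.
have [k [_ [gam [gam_morph gamE]]]] := pa_image_factor g i 0.
have [K [le_iK [phi [phi_morph phiE]]]] := pa_image_factor f k i.
have [iota [iota_morph iotaE]] := factor_embedding S0 Sdec Sbox le_iK.
have comp_id x : val (gam (phi (iota x))) ord_max = val (iota x) (inord i).
  have [b bE] := pa_point_lift (iota x : pa_var X K).
  rewrite -bE -phiE -gamE fK -[LHS]/(pa_coord b i).
  by rewrite (pa_coordE b (inord i : 'I_K.+1)) inordK.
have mcoord_full (v : 'M[F]_(1, a)) : v != 0 ->
    exists x : full_variety F 1 a, mcoord (val x) v.
  move=> v0; have [|z zv] := @mcoord_of F 1 a v.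
    by move=> r; rewrite row_id.
  have zX : z \in (full_variety F 1 a : set _) by rewrite inE.
  by exists (SigSub zX).
have r0_lt : (0 < a)%N := ltnW a1.
pose r0 : 'I_a := Ordinal r0_lt; pose r1 : 'I_a := Ordinal a1.
have delta_neq0 r : (delta_mx 0 r : 'rV[F]_a) != 0.
  by apply/rV0Pn; exists r; rewrite mxE !eqxx oner_neq0.
have [x0 x0v] := mcoord_full _ (delta_neq0 r0).
have phi_iota : vmorphism (phi \o iota) by exact: vmorphism_comp.
have Phi_ex : forall j : 'I_k.+1, exists Phi : 'I_d -> mpoly (1 * a) F, exists e,
    (forall l, multihomog (fun=> e) (Phi l)) /\
    forall (x : full_variety F 1 a) M, mcoord (val x) M ->
      hcoord (val (phi (iota x)) j) (\row_l mxeval M (Phi l)).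
  move=> j.
  have [|//|H [e [He HP]]] := @morphism_representation F (full_variety F 1 a)
    (pa_var Y k) (phi \o iota) j phi_iota _ _ x0; first by [].
  exists H, (e ord0); split=> // l mm /He mme i'; by rewrite [i']ord1.
have [Phi /choice[e PhiP]] := choice Phi_ex.
have Y_full z : @vset F (pa_var Y k) z := free_pointn_full z.
have [G [e' [Ge GP]]] := @morphism_representation F (pa_var Y k) (pa_var X i) gam
  ord_max gam_morph Y_full d_pos (phi (iota x0)).
pose N (v : 'rV[F]_a) : 'M[F]_(k.+1, d) := \matrix_(j, l) mxeval v (Phi j l).
have NP (x : full_variety F 1 a) v : mcoord (val x) v -> mcoord (val (phi (iota x)))
  (N v).
  move=> xv j; rewrite (_ : row j (N v) = \row_l mxeval v (Phi j l)).
    by case: (PhiP j) => _; apply.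
  by apply/rowP => l; rewrite !mxE.
pose h r v := mxeval (N v) (G (@enum_val _ (mem (S i)) r)).
have comp_coord v : v != 0 -> exists c, c != 0 /\ forall r, h r v = c * v 0 r.
  move=> v0; have [x xv] := mcoord_full v v0.
  have xv0 : hcoord (val x ord0) v by have := xv ord0; rewrite row_id.
  have := GP _ _ (NP _ _ xv);
    rewrite comp_id => /(hcoord_scale (iotaE _ _ xv0))[c c0 cE].
  exists c; split=> // r; have /rowP /(_ (enum_val r)) := cE.
  by rewrite mxE [X in _ = X -> _]mxE coord_inclE.
have /choice[c cP] : forall v, exists c, v != 0 -> c != 0 /\ forall r, h r v = c * v
  0 r.
  move=> v; have [->|/comp_coord[c cP]] := eqVneq v 0; first by exists 0; rewrite eqxx.
  by exists c.
(* The degree of the composite: row [j] of [N v] has degree [e j] in [v], and [G] has degree [e' j]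
   in that row. *)
pose D := (\sum_j e j * e' j)%N.
have h_scale r s v : h r (s *: v) = s ^+ D * h r v.
  have -> : h r (s *: v) = mxeval (row_scale (fun j => s ^+ e j) (N v)) (G (enum_val
    r)).
    congr mxeval; apply/matrixP => j l; rewrite !mxE.
    have -> : s *: v = row_scale (fun=> s) v by apply/matrixP => i' l'; rewrite !mxE.
    by rewrite (mxeval_scale _ _ (proj1 (PhiP j) l)) big_ord1.
  rewrite (mxeval_scale _ _ (Ge _)); congr (_ * _).
  by rewrite /D expr_sum; apply: eq_bigr => j _; rewrite exprM.
have h_poly r u v : exists p : {poly F}, forall t, p.[t] = h r (u + t *: v).
  have /choice[n nP] : forall jl : 'I_k.+1 * 'I_d, exists p : {poly F},
      forall t, p.[t] = mxeval (u + t *: v) (Phi jl.1 jl.2).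
    move=> [j l]; have [p pP] := line_eval (Phi j l)
      (fun w => (mxvec u 0 w)%:P + (mxvec v 0 w) *: 'X).
    exists p => t; rewrite pP; apply: meval_eq => w.
    by rewrite hornerD hornerC hornerZ hornerX; case/mxvec_indexP: w => i' l';
      rewrite !mxvecE !mxE mulrC.
  have [p pP] := line_eval (G (enum_val r)) (fun w => mxvec (\matrix_(j, l) n (j, l))
    0 w).
  exists p => t; rewrite pP; apply: meval_eq => w.
  by case/mxvec_indexP: w => j l; rewrite !mxvecE !mxE nP.
have D1 : D = 1%N.
  apply: (@identity_degree1 F a r0 r1 D (h r0) (h r1) c) => //.
    by move=> v /cP[c0 hE]; split.
have [j [ej e'j]] : exists j, e j = 1%N /\ e' j = 1%N.
  apply: contrapT => /forallNP none; suff : D = 0%N by rewrite D1.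
  have le1 j : (e j * e' j <= 1)%N by rewrite -[X in (_ <= X)%N]D1 /D (bigD1 j) //=
    leq_addr.
  apply: big1 => j _; move: (le1 j) (none j);
    case: (e j * e' j)%N (muln_eq1 (e j) (e' j)) => [//|[|//]].
  by move=> /esym /andP[/eqP -> /eqP ->] _ [].
apply/eqP; rewrite eqn_leq; apply/andP; split.
  have [B BP] := row_mx_linear (i := ord0) (0 : 'M_(1, a)) (proj1 (PhiP j)) ej.
  apply: (injective_mx_leq (B := B)) => v v0; rewrite -BP.
  have -> : set_row 0 ord0 v = v.
    by apply/matrixP => i' l; rewrite [i']ord1 !mxE.
  have [x xv] := mcoord_full v v0.
  exact: hcoord_neq0 (proj2 (PhiP j) _ _ xv).
have [M0 M0P] := mcoord_exists (val (phi (iota x0))).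
(* For the other inequality, the remaining factors of [Y] are fixed at a point and factor [j]
   varies. *)
have [B BP] : exists B : 'M[F]_(d, m), forall v,
    \row_l mxeval (set_row M0 j v) (G l) = v *m B := row_mx_linear M0 Ge e'j.
apply: (@injective_mx_leq F d #|S i| (B *m (coord_incl (S i))^T)) => v v0.
have [|z zM] := @mcoord_of F k.+1 d (set_row M0 j v).
  by move=> j'; rewrite rowK; case: (j' == j) => //; exact: hcoord_neq0 (M0P j').
have zY : z \in (pa_var Y k : set _) by rewrite inE; exact: Y_full.
have := GP (SigSub zY) _ zM; rewrite BP => gz.
have [b bE] := pa_point_lift (gam (SigSub zY) : pa_var X i).
(* Values of [g] lie in the box, so they stay non-zero when projected to the coordinates in
   [S i]. *)
have supp l : (v *m B) 0 l != 0 -> l \in S i.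
  by apply: (pa_coord_box Sdec Sbox (a := b)); rewrite /pa_coord bE.
have /rV0Pn[l vBl] := hcoord_neq0 gz; apply/rV0Pn.
pose r := enum_rank_in (supp l vBl) l; exists r.
have inclE l' : (coord_incl (S i))^T l' r = (l' == l)%:R :> F.
  by rewrite !mxE eqxx /r enum_rankK_in ?supp.
rewrite mulmxA mxE (bigD1 l) //= big1 ?addr0 => [|l' /negPf nl].
  by rewrite inclE eqxx mulr1.
by rewrite inclE nl mulr0.
Qed.

Hypothesis gK : cancel (pa_image g) (pa_image f).

(* Otherwise the factors of [X] are eventually points, so that the point
   [pa_image g b] only depends on a truncation of [b]. *)
Lemma factor_card_gt1 i : (1 < d)%N -> (1 < #|S i|)%N.
Proof.
move=> d1; rewrite ltnNge; apply/negP => Si1.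
have [k [_ [gam [_ gamE]]]] := pa_image_factor g i 0.
have delta_neq0 r : (delta_mx 0 r : 'rV[F]_d) != 0.
  by apply/rV0Pn; exists r; rewrite mxE !eqxx oner_neq0.
pose r0 := Ordinal d_pos; pose r1 := Ordinal d1.
have [L0 L0r] := hcoord_of (delta_neq0 r0); have [L1 L1r] := hcoord_of (delta_neq0 r1).
(* [b] and [b'] agree up to coordinate [k] and differ from coordinate [k.+1] on. *)
have [b bE] := point_seqs_pa_point (free_point_seqs (fun=> L0)).
have [b' b'E] := point_seqs_pa_point
  (free_point_seqs (fun n => if (n <= k)%N then L0 else L1)).
have bk : sval b k = sval b' k.
  by apply: val_inj; rewrite bE b'E; apply/ffunP => l; rewrite !ffunE -ltnS ltn_ord.
have gi : sval (pa_image g b) i = sval (pa_image g b') i by rewrite !gamE bk.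
have Ssub j : (i <= j)%N -> S j \subset S i.
  move=> le_ij; rewrite -(subnK le_ij); elim: (j - i)%N => [|l IHl]; first exact: subxx.
  exact: fintype.subset_trans (Sdec _) IHl.
have gb : pa_image g b = pa_image g b'.
  apply: pa_point_eq => j; have [le_ji|lt_ij] := leqP j i.
    have jE := inordK (le_ji : (j < i.+1)%N).
    rewrite -jE -(pa_coordE (pa_image g b) (inord j : 'I_i.+1)) gi.
    exact: (pa_coordE (pa_image g b') (inord j : 'I_i.+1)).
  (* Beyond [i] the set [S j] has a single element, so this factor is a point. *)
  have [s sS] := finset.set0Pn _ (S0 j).
  have uniq_s t : t \in S j -> t = s.
    have /card_le1_eqP Sj1 := leq_trans (subset_leq_card (Ssub _ (ltnW lt_ij))) Si1.
    by move=> tS; exact: Sj1 s t sS tS.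
  have coordP c : hcoord (pa_coord c j) (delta_mx 0 s : 'rV[F]_m).
    have [v cv] := hcoord_exists (pa_coord c j).
    have vE t : t != s -> v 0 t = 0.
      move=> nt; apply/eqP; apply: contraNT nt => vt; apply/eqP; apply: uniq_s.
      exact: pa_coord_box cv vt.
    have vs : v 0 s != 0.
      by have /rV0Pn[t] := hcoord_neq0 cv; have [->|/vE ->] := eqVneq t s;
        rewrite ?eqxx.
    rewrite (_ : delta_mx 0 s = (v 0 s)^-1 *: v); first by apply: hcoord_scaled;
      rewrite ?invr_eq0.
    apply/rowP => t; rewrite !mxE eqxx /=.
    have [->|nt] := eqVneq t s; [by rewrite mulVf | by rewrite (vE t nt) mulr0].
  exact: hcoord_inj (coordP _) (coordP _).
have bb' : b = b' by apply: (can_inj gK).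
have := congr1 (fun c => pa_coord c k.+1) bb'.
rewrite /pa_coord bE b'E !ffunE /= ltnn => L01.
have [c _ /rowP /(_ r1)] := hcoord_scale L0r (eq_ind_r (fun L => hcoord L _) L1r L01).
by rewrite !mxE /= mulr0 => /eqP; rewrite oner_eq0.
Qed.

Lemma factor_card_eq i : #|S i| = d.
Proof.
have [d1|d1] := ltnP 1 d; first exact: factor_card (factor_card_gt1 i d1).
have [a1|a1] := ltnP 1 #|S i|; first exact: factor_card.
have -> : d = 1%N by apply/eqP; rewrite eqn_leq d1.
by apply/eqP; rewrite eqn_leq a1 card_gt0 S0.
Qed.

End FactorDimensions.

Section Isomorphic.
Variables (F : closedFieldType) (A : monomial_algebra F) (d : nat).
Hypothesis A_prol : prolongable A.
Let X := point_variety A.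
Let Y := point_variety (free_monomial_algebra F d).
Variables (f : pa_morphism X Y) (g : pa_morphism Y X).
Hypothesis fK : cancel (pa_image f) (pa_image g).
Hypothesis gK : cancel (pa_image g) (pa_image f).

Lemma pa_point_exists : exists a : pa_point X, True.
Proof.
have [|p Ap _] := @word_point F A A_prol [::]; first by rewrite monomial_nil oner_neq0.
by have [a _] := point_seqs_pa_point Ap; exists a.
Qed.

Lemma isomorphic_pos : (0 < d)%N.
Proof.
have [a _] := pa_point_exists; pose L : proj_space F d := pa_coord (pa_image f a) 0.
have [v Lv] := hcoord_exists L; have /rV0Pn[r _] := hcoord_neq0 Lv.
exact: leq_trans (ltn_ord r).
Qed.

(** The variety is the image of a level of [Y], a full product of projective spaces; every point is
    reached because [g] is surjective on points. *)
Lemma isomorphic_irreducible n : virreducible (pointn A n).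
Proof.
have [k [_ [gam [gam_morph gamE]]]] := pa_image_factor g n 0.
apply: (virreducible_image gam_morph) => [x|].
  have [a <-] := pa_point_lift (x : pa_var X n).
  by exists (sval (pa_image f a) k); rewrite -gamE fK.
apply: virreducible_full; [exact: free_pointn_full | exact: isomorphic_pos |].
by have [a _] := pa_point_exists; exists (sval (pa_image f a) k).
Qed.

(** Decreasing sets of constant cardinality are constant, so [box_quotient] applies with [N = 0],
    and then the kernel itself is zero. *)
Lemma isomorphic_free : is_free_algebra A.
Proof.
have [S [S0 Sdec Sbox]] := language_box A_prol isomorphic_irreducible.
have Sd := factor_card_eq S0 Sdec Sbox fK isomorphic_pos gK.
have Sconst i : S i = S 0%N.
  elim: i => // i <-; apply/eqP; rewrite eqEcard Sdec !Sd leqnn //.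
have [|phi [phi_surj phi_ker]] := box_quotient (N := 0) S0 Sdec Sbox.
  by move=> i _; exact: Sconst.
have phi_inj : injective phi.
  move=> a b ab; apply/eqP; rewrite -subr_eq0; apply/eqP.
  have := phi_ker [:: a - b] erefl; rewrite big_seq1; apply=> c.
  by rewrite inE => /eqP ->; rewrite rmorphB /= ab subrr.
have [psi psiP] := choice phi_surj.
by exists _, phi, psi => // a; apply: phi_inj; rewrite psiP.
Qed.

End Isomorphic.

Theorem theorem1p3 (F : closedFieldType) :
  (forall A : monomial_algebra F,
     prolongable A -> pa_irreducible (point_variety A) ->
     exists (d : nat) (phi : {lrmorphism A -> free_alg F d}),
       (forall f : free_alg F d, exists a : A, phi a = f) /\
       nilpotent_ideal [set a : A | phi a = 0]) /\
  (forall (A : monomial_algebra F) (d : nat),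
     prolongable A ->
     pa_isomorphic (point_variety A)
       (point_variety (free_monomial_algebra F d)) ->
     is_free_algebra A).
Proof.
split=> [A A_prol A_irr|A d A_prol [f [g [fK gK]]]]; last exact: isomorphic_free fK gK.
have [S [S0 Sdec Sbox]] := language_box A_prol A_irr.
have [N Sstab] := decreasing_sets_stable Sdec.
have [phi [phi_surj phi_ker]] := box_quotient S0 Sdec Sbox Sstab.
by exists #|S N|, phi; split=> //; exists N.+1.
Qed.
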